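(* Let $R$ be a commutative ring, $S$ a commutative $R$-algebra that is faithfully projective as an $R$-module, and $\mathcal C$ an Azumaya $S/R$-coring. Then ${}_S\mathrm{Hom}(\mathcal C,S)$ and $\mathrm{Hom}_S(\mathcal C,S)$ (left, respectively right, $S$-linear maps $\mathcal C\to S$) are Azumaya $R$-algebras split by $S$.
   Context: Faithfully projective means finitely generated, projective and faithful. $\otimes=\otimes_R$. The map $\eta_i:S^{\otimes 2}\to S^{\otimes 3}$ ($i=1,2,3$) inserts $1$ in the $i$-th position; for an $S\otimes S$-module $M$, $M_i=M\otimes_{S^{\otimes 2},\eta_i}S^{\otimes3}$ and $m_i=m\otimes1\in M_i$. An $S\otimes S$-module is viewed as an $S$-bimodule via $smt=(s\otimes t)m$. An $S/R$-coring is an $S\otimes S$-module $\mathcal C$ with $S$-bimodule maps $\Delta:\mathcal C\to\mathcal C\otimes_S\mathcal C$, $\Delta(c)=c_{(1)}\otimes_S c_{(2)}$, and $\varepsilon:\mathcal C\to S$ satisfying coassociativity and the counit property. To $\Delta$ corresponds the $S^{\otimes 3}$-linear map $\tilde\Delta:\mathcal C_2\to\mathcal C_3\otimes_{S^{\otimes3}}\mathcal C_1$, $\tilde\Delta(c_2)=c_{(1)3}\otimes c_{(2)1}$. An Azumaya $S/R$-coring ($S$ faithfully flat over $R$) is an $S/R$-coring that is faithfully projective as an $S\otimes S$-module and such that $\tilde\Delta$ is an isomorphism. The multiplication on ${}_S\mathrm{Hom}(\mathcal C,S)$ is $(g\# f)(c)=f(c_{(1)}g(c_{(2)}))$, and on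 $\mathrm{Hom}_S(\mathcal C,S)$ it is $(f\# g)(c)=f(g(c_{(1)})c_{(2)})$; in both cases the unit is $\varepsilon$. An $R$-algebra $A$ is Azumaya if there is a commutative faithfully flat $R$-algebra $T$ with $A\otimes T\cong\mathrm{End}_T(P)$ as $T$-algebras for some faithfully projective $T$-module $P$; $A$ is split by $S$ if its class lies in the kernel of $\mathrm{Br}(R)\to\mathrm{Br}(S)$, $[A]\mapsto[A\otimes S]$ (equivalently $A\otimes S\cong\mathrm{End}_S(P)$ for a faithfully projective $S$-module $P$). *)

(* Defs.v *)
From HB Require Import structures.
From mathcomp Require Import all_boot all_algebra generic_quotient.
From mathcomp Require Import boolp classical_sets functions.

Set Implicit Arguments.
Unset Strict Implicit.
Unset Printing Implicit Defensive.

Import GRing.Theory.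
Local Open Scope ring_scope.
Local Open Scope quotient_scope.

(* All rings are of the "Pz" kind, for which 1 = 0 is allowed: "commutative
   ring" does not exclude the zero ring, and a tensor product of nonzero
   algebras may be zero.  The algebra structures of ssralg are only available
   for nonzero rings, hence an R-algebra is given here by its structure
   morphism. *)

Definition restr (A B : pzRingType) (f : {rmorphism A -> B}) (M : lmodType B) :
  Type := M.

Section Restriction.
Variables (A B : pzRingType) (f : {rmorphism A -> B}) (M : lmodType B).
Local Notation restr := (restr f M).

HB.instance Definition _ := GRing.Zmodule.copy restr M.

Definition restr_scale (a : A) (m : restr) : restr := f a *: (m : M).

Let restr_scaleA a b m :
  restr_scale a (restr_scale b m) = restr_scale (a * b) m.
Proof. by rewrite /restr_scale scalerA rmorphM. Qed.
Let restr_scale1 : left_id 1 restr_scale.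
Proof. by move=> m; rewrite /restr_scale rmorph1 scale1r. Qed.
Let restr_scaleDr : right_distributive restr_scale +%R.
Proof. by move=> a m n; rewrite /restr_scale scalerDr. Qed.
Let restr_scaleDl m : {morph restr_scale^~ m : a b / a + b}.
Proof. by move=> a b; rewrite /restr_scale rmorphD scalerDl. Qed.

HB.instance Definition _ := GRing.Zmodule_isLmodule.Build A restr
  restr_scaleA restr_scale1 restr_scaleDr restr_scaleDl.

Lemma restrE (a : A) (m : restr) : a *: m = f a *: (m : M).
Proof. by []. Qed.

End Restriction.

Section Tensor.
Variables (R : comPzRingType) (M N : lmodType R).

Definition balanced (G : zmodType) (h : M -> N -> G) : Prop :=
  [/\ forall m m' n, h (m + m') n = h m n + h m' n,
      forall m n n', h m (n + n') = h m n + h m n'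
    & forall r m n, h (r *: m) n = h m (r *: n)].

Definition eval_word (G : zmodType) (h : M -> N -> G) (u : seq (M * N)) : G :=
  \sum_(p <- u) h p.1 p.2.

(* A tensor is represented by a list of pairs (m, n), standing for the sum of
   the m (x) n; two lists define the same tensor when they cannot be told apart
   by a balanced map.  This is the quotient of the sums of pairs satisfying the
   universal property: see [tens_lift], [tens_liftE] and [tens_ind]. *)
Definition word_eq (u v : seq (M * N)) : bool :=
  `[< forall (G : zmodType) (h : M -> N -> G),
        balanced h -> eval_word h u = eval_word h v >].

Let word_eq_refl : reflexive word_eq.
Proof. by move=> u; apply/asboolP. Qed.
Let word_eq_sym : symmetric word_eq.
Proof.
by move=> u v; apply/asboolP/asboolP => e G h hb; rewrite e.
Qed.
Let word_eq_trans : transitive word_eq.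
Proof.
move=> v u w /asboolP e1 /asboolP e2; apply/asboolP => G h hb.
by rewrite e1 // e2.
Qed.

Canonical word_equiv := EquivRel word_eq word_eq_refl word_eq_sym word_eq_trans.

Definition tens : Type := {eq_quot word_equiv}.

HB.instance Definition _ := Choice.copy tens {eq_quot word_equiv}.

Definition tens_of (u : seq (M * N)) : tens := \pi_{eq_quot word_equiv} u.
Definition word_of (x : tens) : seq (M * N) :=
  repr (x : {eq_quot word_equiv}).

Definition pure (m : M) (n : N) : tens := tens_of [:: (m, n)].

Definition tens_eval (G : zmodType) (h : M -> N -> G) (x : tens) : G :=
  eval_word h (word_of x).

Lemma tens_eval_of (G : zmodType) (h : M -> N -> G) u :
  balanced h -> tens_eval h (tens_of u) = eval_word h u.
Proof.
move=> hb; rewrite /tens_eval /word_of /tens_of.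
have /eqmodP /asboolP := reprK (\pi_{eq_quot word_equiv} u).
exact.
Qed.

Lemma tens_sep (x y : tens) :
  (forall (G : zmodType) (h : M -> N -> G),
     balanced h -> tens_eval h x = tens_eval h y) -> x = y.
Proof.
move=> e; rewrite -[x](@reprK _ {eq_quot word_equiv}).
rewrite -[y](@reprK _ {eq_quot word_equiv}).
by apply/eqmodP/asboolP.
Qed.

Definition tens_zero : tens := tens_of [::].
Definition tens_add (x y : tens) : tens := tens_of (word_of x ++ word_of y).
Definition tens_opp (x : tens) : tens :=
  tens_of [seq (- p.1, p.2) | p <- word_of x].

Section Eval.
Variables (G : zmodType) (h : M -> N -> G).
Hypothesis hb : balanced h.

Lemma balanced0l n : h 0 n = 0.
Proof.
by case: hb => h1 _ _; apply: (addIr (h 0 n)); rewrite -h1 !add0r.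
Qed.

Lemma balancedNl m n : h (- m) n = - h m n.
Proof.
case: hb => h1 _ _; apply: (addIr (h m n)).
by rewrite -h1 !addNr balanced0l.
Qed.

Lemma tens_eval0 : tens_eval h tens_zero = 0.
Proof. by rewrite tens_eval_of // /eval_word big_nil. Qed.

Lemma tens_evalD x y :
  tens_eval h (tens_add x y) = tens_eval h x + tens_eval h y.
Proof. by rewrite tens_eval_of // /eval_word big_cat. Qed.

Lemma tens_evalN x : tens_eval h (tens_opp x) = - tens_eval h x.
Proof.
rewrite tens_eval_of // /eval_word big_map -sumrN.
by apply: eq_bigr => p _; rewrite balancedNl.
Qed.

End Eval.

Let tens_addA : associative tens_add.
Proof.
by move=> x y z; apply: tens_sep => G h hb; rewrite !tens_evalD // addrA.
Qed.
Let tens_addC : commutative tens_add.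
Proof.
by move=> x y; apply: tens_sep => G h hb; rewrite !tens_evalD // addrC.
Qed.
Let tens_add0 : left_id tens_zero tens_add.
Proof.
move=> x; apply: tens_sep => G h hb.
by rewrite tens_evalD // tens_eval0 // add0r.
Qed.
Let tens_addN : left_inverse tens_zero tens_opp tens_add.
Proof.
move=> x; apply: tens_sep => G h hb.
by rewrite tens_evalD // tens_evalN // tens_eval0 // addNr.
Qed.

HB.instance Definition _ :=
  GRing.isZmodule.Build tens tens_addA tens_addC tens_add0 tens_addN.

Lemma pureDl m m' n : pure (m + m') n = pure m n + pure m' n.
Proof.
apply: tens_sep => G h hb; rewrite tens_evalD //.
rewrite !tens_eval_of // /eval_word !big_seq1.
by case: hb => h1 h2 h3; rewrite h1.
Qed.

Lemma pureDr m n n' : pure m (n + n') = pure m n + pure m n'.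
Proof.
apply: tens_sep => G h hb; rewrite tens_evalD //.
rewrite !tens_eval_of // /eval_word !big_seq1.
by case: hb => h1 h2 h3; rewrite h2.
Qed.

Lemma pureZ r m n : pure (r *: m) n = pure m (r *: n).
Proof.
apply: tens_sep => G h hb.
rewrite !tens_eval_of // /eval_word !big_seq1.
by case: hb => h1 h2 h3; rewrite h3.
Qed.

Lemma balanced_pure : balanced pure.
Proof. by split=> *; [exact: pureDl | exact: pureDr | exact: pureZ]. Qed.

Lemma tens_ind (P : tens -> Prop) :
  (forall m n, P (pure m n)) -> (forall x y, P x -> P y -> P (x + y)) ->
  forall x, P x.
Proof.
move=> Pp PD x.
have P0 : P 0.
  have -> : 0 = pure 0 0 :> tens by rewrite (balanced0l balanced_pure).
  exact: Pp.
rewrite -[x](@reprK _ {eq_quot word_equiv}) -/(word_of x) -/(tens_of _).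
elim: (word_of x) => [|[m n] u IH]; first exact: P0.
suff -> : tens_of ((m, n) :: u) = pure m n + tens_of u by exact: PD.
apply: tens_sep => G h hb; rewrite tens_evalD //.
by rewrite !tens_eval_of // /eval_word big_cons big_seq1.
Qed.

Section Lift.
Variables (G : zmodType) (h : M -> N -> G) (hb : balanced h).

(* The unused [hb] is kept as an argument so that the additive structure of
   [tens_lift hb] can be inferred; likewise in [mk_left] and [mk_right]. *)
Definition tens_lift (x : tens) : G := let _ := hb in tens_eval h x.

Let tens_lift_additive : nmod_morphism tens_lift.
Proof. by split=> [|x y]; [exact: tens_eval0 | exact: tens_evalD]. Qed.

HB.instance Definition _ :=
  GRing.isNmodMorphism.Build tens G tens_lift tens_lift_additive.

Lemma tens_liftE m n : tens_lift (pure m n) = h m n.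
Proof. by rewrite /tens_lift tens_eval_of // /eval_word big_seq1. Qed.

End Lift.

Lemma tens_eq (G : zmodType) (f g : {additive tens -> G}) :
  (forall m n, f (pure m n) = g (pure m n)) -> f =1 g.
Proof.
move=> e; apply: tens_ind => // x y ex ey.
by rewrite !raddfD /= ex ey.
Qed.

Let scale_balanced (r : R) : balanced (fun m n => pure (r *: m) n).
Proof.
split=> [m m' n|m n n'|r' m n]; first by rewrite scalerDr pureDl.
  by rewrite pureDr.
by rewrite scalerA mulrC -scalerA pureZ.
Qed.

Definition tens_scale (r : R) : tens -> tens := tens_lift (scale_balanced r).

HB.instance Definition _ r := GRing.Additive.on (tens_scale r).

Lemma tens_scale_pure r m n : tens_scale r (pure m n) = pure (r *: m) n.
Proof. exact: tens_liftE. Qed.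

Let tens_scaleA a b x : tens_scale a (tens_scale b x) = tens_scale (a * b) x.
Proof.
elim/tens_ind: x => [m n|x y ex ey]; last by rewrite !raddfD /= ex ey.
by rewrite !tens_scale_pure scalerA.
Qed.
Let tens_scale1 : left_id 1 tens_scale.
Proof.
elim/tens_ind => [m n|x y ex ey]; last by rewrite !raddfD /= ex ey.
by rewrite !tens_scale_pure scale1r.
Qed.
Let tens_scaleDr : right_distributive tens_scale +%R.
Proof. by move=> a x y; rewrite raddfD. Qed.
Let tens_scaleDl x : {morph tens_scale^~ x : a b / a + b}.
Proof.
move=> a b; elim/tens_ind: x => [m n|x y ex ey].
  by rewrite !tens_scale_pure scalerDl pureDl.
by rewrite !raddfD /= ex ey addrACA.
Qed.

HB.instance Definition _ := GRing.Zmodule_isLmodule.Build R tens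
  tens_scaleA tens_scale1 tens_scaleDr tens_scaleDl.

Lemma scale_pure r m n : r *: pure m n = pure (r *: m) n.
Proof. exact: tens_scale_pure. Qed.

End Tensor.

Section TensorMap.
Variables (R : comPzRingType) (M M' N N' : lmodType R).
Variables (f : {linear M -> M'}) (g : {linear N -> N'}).

Let tmap_balanced : balanced (fun m n => pure (f m) (g n)).
Proof.
split=> [m m' n|m n n'|r m n].
- by rewrite linearD pureDl.
- by rewrite linearD pureDr.
- by rewrite !linearZ /= pureZ.
Qed.

Definition tmap : tens M N -> tens M' N' := tens_lift tmap_balanced.

HB.instance Definition _ := GRing.Additive.on tmap.

Lemma tmapE m n : tmap (pure m n) = pure (f m) (g n).
Proof. exact: tens_liftE. Qed.

Let tmap_scalable : scalable tmap.
Proof.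
move=> r x; elim/tens_ind: x => [m n|x y ex ey].
  by rewrite scale_pure !tmapE linearZ scale_pure.
by rewrite scalerDr !raddfD /= ex ey.
Qed.

HB.instance Definition _ :=
  GRing.isScalable.Build R (tens M N) (tens M' N') *:%R tmap tmap_scalable.

End TensorMap.

Section ModuleProperties.
Variable R : comPzRingType.

Definition fin_generated (M : lmodType R) : Prop :=
  exists (n : nat) (e : 'I_n -> M),
    forall m : M, exists c : 'I_n -> R, m = \sum_i c i *: e i.

Definition projective (M : lmodType R) : Prop :=
  forall (N N' : lmodType R) (p : {linear N -> N'}) (f : {linear M -> N'}),
    (forall y, exists x, p x = y) ->
    exists g : {linear M -> N}, forall m, p (g m) = f m.

Definition faithful (M : lmodType R) : Prop :=
  forall r : R, (forall m : M, r *: m = 0) -> r = 0.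

Definition faithfully_projective (M : lmodType R) : Prop :=
  [/\ fin_generated M, projective M & faithful M].

Definition exact_at (X Y Z : zmodType) (f : X -> Y) (g : Y -> Z) : Prop :=
  forall y, g y = 0 <-> exists x, f x = y.

Definition faithfully_flat (M : lmodType R) : Prop :=
  forall (N N' N'' : lmodType R) (f : {linear N -> N'}) (g : {linear N' -> N''}),
    exact_at f g <->
    exact_at (tmap f (idfun : {linear M -> M}))
             (tmap g (idfun : {linear M -> M})).

End ModuleProperties.

Record ralg (R : comPzRingType) := Ralg {
  ralg_sort :> pzRingType;
  ralg_map : {rmorphism R -> ralg_sort};
  ralg_central : forall r a, ralg_map r * a = a * ralg_map r
}.
Arguments ralg_map {R} A : rename.

Definition amod (R : comPzRingType) (A : ralg R) : lmodType R :=
  restr (ralg_map A) A^o.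

Definition alg_iso (R : comPzRingType) (A B : ralg R) : Prop :=
  exists F : {rmorphism A -> B},
    bijective F /\ forall r, F (ralg_map A r) = ralg_map B r.

Definition calg (R S : comPzRingType) (phi : {rmorphism R -> S}) : ralg R :=
  @Ralg R S phi (fun r s => mulrC (phi r) s).

Section AlgebraTensor.
Variables (R : comPzRingType) (A B : ralg R).

Definition atens : Type := tens (amod A) (amod B).

HB.instance Definition _ := GRing.Zmodule.copy atens (tens (amod A) (amod B)).

Definition apure (a : A) (b : B) : atens := @pure R (amod A) (amod B) a b.

Lemma apureDl a a' b : apure (a + a') b = apure a b + apure a' b.
Proof. exact: (@pureDl R (amod A) (amod B)). Qed.
Lemma apureDr a b b' : apure a (b + b') = apure a b + apure a b'.
Proof. exact: (@pureDr R (amod A) (amod B)). Qed.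
Lemma apureZ r a b : apure (ralg_map A r * a) b = apure a (ralg_map B r * b).
Proof. exact: (@pureZ R (amod A) (amod B)). Qed.

Lemma atens_ind (P : atens -> Prop) :
  (forall a b, P (apure a b)) -> (forall x y, P x -> P y -> P (x + y)) ->
  forall x, P x.
Proof. exact: (@tens_ind R (amod A) (amod B)). Qed.

Section Lift.
Variables (G : zmodType) (h : A -> B -> G).
Hypothesis (hDl : forall a a' b, h (a + a') b = h a b + h a' b).
Hypothesis (hDr : forall a b b', h a (b + b') = h a b + h a b').
Hypothesis (hZ : forall r a b, h (ralg_map A r * a) b = h a (ralg_map B r * b)).

Let h_balanced : @balanced R (amod A) (amod B) G h.
Proof. by split=> *; [exact: hDl | exact: hDr | exact: hZ]. Qed.

Definition atens_lift : atens -> G := tens_lift h_balanced.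

HB.instance Definition _ := GRing.Additive.copy atens_lift (tens_lift h_balanced).

Lemma atens_liftE a b : atens_lift (apure a b) = h a b.
Proof. exact: (tens_liftE h_balanced). Qed.

End Lift.

Section Mul2.
Variables (a : A) (b : B).

Let h (x : A) (y : B) : atens := apure (a * x) (b * y).
Let hDl x x' y : h (x + x') y = h x y + h x' y.
Proof. by rewrite /h mulrDr apureDl. Qed.
Let hDr x y y' : h x (y + y') = h x y + h x y'.
Proof. by rewrite /h mulrDr apureDr. Qed.
Let hZ r x y : h (ralg_map A r * x) y = h x (ralg_map B r * y).
Proof.
by rewrite /h !mulrA -!ralg_central -!mulrA apureZ.
Qed.

Definition atens_mul_pure : atens -> atens := atens_lift hDl hDr hZ.

HB.instance Definition _ := GRing.Additive.on atens_mul_pure.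

Lemma atens_mul_pureE x y :
  atens_mul_pure (apure x y) = apure (a * x) (b * y).
Proof. exact: atens_liftE. Qed.

End Mul2.

Let mulDl a a' b :
  atens_mul_pure (a + a') b = atens_mul_pure a b + atens_mul_pure a' b.
Proof.
apply/funext; elim/atens_ind => [x y|x y ex ey].
  by rewrite addrfctE !atens_mul_pureE mulrDl apureDl.
move: ex ey; rewrite !addrfctE !raddfD /= => -> ->.
by rewrite addrACA.
Qed.
Let mulDr a b b' :
  atens_mul_pure a (b + b') = atens_mul_pure a b + atens_mul_pure a b'.
Proof.
apply/funext; elim/atens_ind => [x y|x y ex ey].
  by rewrite addrfctE !atens_mul_pureE mulrDl apureDr.
move: ex ey; rewrite !addrfctE !raddfD /= => -> ->.
by rewrite addrACA.
Qed.
Let mulZ r a b :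
  atens_mul_pure (ralg_map A r * a) b = atens_mul_pure a (ralg_map B r * b).
Proof.
apply/funext; elim/atens_ind => [x y|x y ex ey].
  by rewrite !atens_mul_pureE -!mulrA apureZ.
by rewrite !raddfD /= ex ey.
Qed.

Definition atens_mul (x : atens) : atens -> atens :=
  atens_lift mulDl mulDr mulZ x.
Definition atens_one : atens := apure 1 1.

Let atens_mulDl : left_distributive atens_mul +%R.
Proof. by move=> x y z; rewrite /atens_mul raddfD. Qed.
Let atens_mulDr : right_distributive atens_mul +%R.
Proof.
move=> x y z; elim/atens_ind: x => [a b|x x' ex ey].
  by rewrite /atens_mul atens_liftE raddfD.
by rewrite !atens_mulDl ex ey addrACA.
Qed.
Let atens_mul_apure a b a' b' :
  atens_mul (apure a b) (apure a' b') = apure (a * a') (b * b').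
Proof. by rewrite /atens_mul atens_liftE atens_mul_pureE. Qed.
Let atens_mulA : associative atens_mul.
Proof.
move=> x y z; elim/atens_ind: x => [a b|x x' ex ey]; last first.
  by rewrite !atens_mulDl ex ey.
elim/atens_ind: y => [a' b'|y y' ex ey]; last first.
  by rewrite !(atens_mulDl, atens_mulDr) ex ey.
elim/atens_ind: z => [a'' b''|z z' ex ey]; last first.
  by rewrite !atens_mulDr ex ey.
by rewrite !atens_mul_apure !mulrA.
Qed.
Let atens_mul1l : left_id atens_one atens_mul.
Proof.
elim/atens_ind => [a b|x y ex ey]; last by rewrite atens_mulDr ex ey.
by rewrite atens_mul_apure !mul1r.
Qed.
Let atens_mul1r : right_id atens_one atens_mul.
Proof.
elim/atens_ind => [a b|x y ex ey]; last by rewrite atens_mulDl ex ey.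
by rewrite atens_mul_apure !mulr1.
Qed.

HB.instance Definition _ := GRing.Zmodule_isPzRing.Build atens
  atens_mulA atens_mul1l atens_mul1r atens_mulDl atens_mulDr.

Lemma apureM a b a' b' : apure a b * apure a' b' = apure (a * a') (b * b').
Proof. exact: atens_mul_apure. Qed.
Lemma apure1 : apure 1 1 = 1.
Proof. by []. Qed.

Definition ainl (a : A) : atens := apure a 1.
Definition ainr (b : B) : atens := apure 1 b.

Let ainl_additive : nmod_morphism ainl.
Proof.
split=> [|x y]; last exact: apureDl.
by apply: (addIr (ainl 0)); rewrite -apureDl !add0r.
Qed.
Let ainl_monoid : monoid_morphism ainl.
Proof. by split=> // x y; rewrite /ainl apureM mulr1. Qed.
HB.instance Definition _ := GRing.isNmodMorphism.Build A atens ainl ainl_additive.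
HB.instance Definition _ := GRing.isMonoidMorphism.Build A atens ainl ainl_monoid.

Let ainr_additive : nmod_morphism ainr.
Proof.
split=> [|x y]; last exact: apureDr.
by apply: (addIr (ainr 0)); rewrite -apureDr !add0r.
Qed.
Let ainr_monoid : monoid_morphism ainr.
Proof. by split=> // x y; rewrite /ainr apureM mulr1. Qed.
HB.instance Definition _ := GRing.isNmodMorphism.Build B atens ainr ainr_additive.
HB.instance Definition _ := GRing.isMonoidMorphism.Build B atens ainr ainr_monoid.

Let ainl_central r (x : atens) :
  (ainl \o ralg_map A) r * x = x * (ainl \o ralg_map A) r.
Proof.
elim/atens_ind: x => [a b|x y ex ey]; last by rewrite mulrDl mulrDr ex ey.
by rewrite /= !apureM ralg_central mulr1 mul1r.
Qed.

Definition atensor : ralg R := @Ralg R atens (ainl \o ralg_map A) ainl_central.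

End AlgebraTensor.

Section CommutativeTensor.
Variables (R S T : comPzRingType).
Variables (phi : {rmorphism R -> S}) (psi : {rmorphism R -> T}).

Definition ctens : Type := atens (calg phi) (calg psi).

HB.instance Definition _ := GRing.PzRing.copy ctens (atens (calg phi) (calg psi)).

Let ctens_mulC : commutative (@GRing.mul ctens).
Proof.
move=> x y; elim/atens_ind: x => [a b|x x' ex ey]; last first.
  by rewrite mulrDl mulrDr ex ey.
elim/atens_ind: y => [a' b'|y y' ex ey]; last by rewrite mulrDl mulrDr ex ey.
by rewrite !apureM; congr apure; exact: mulrC.
Qed.

HB.instance Definition _ :=
  GRing.PzRing_hasCommutativeMul.Build ctens ctens_mulC.

Definition cpure (s : S) (t : T) : ctens := @apure R (calg phi) (calg psi) s t.

Lemma ctens_ind (P : ctens -> Prop) :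
  (forall a b, P (cpure a b)) -> (forall x y, P x -> P y -> P (x + y)) ->
  forall x, P x.
Proof. exact: (@atens_ind R (calg phi) (calg psi)). Qed.

Definition cinl (s : S) : ctens := cpure s 1.
Definition cinr (t : T) : ctens := cpure 1 t.

HB.instance Definition _ :=
  GRing.RMorphism.copy cinl (@ainl R (calg phi) (calg psi)).
HB.instance Definition _ :=
  GRing.RMorphism.copy cinr (@ainr R (calg phi) (calg psi)).

Lemma cinlE s : cinl s = cpure s 1. Proof. by []. Qed.
Lemma cinrE t : cinr t = cpure 1 t. Proof. by []. Qed.
Lemma cpureM s t s' t' : cpure s t * cpure s' t' = cpure (s * s') (t * t').
Proof. exact: (@apureM R (calg phi) (calg psi)). Qed.

Lemma cin_base r : cinl (phi r) = cinr (psi r).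
Proof.
rewrite cinlE cinrE -[phi r]mulr1 -[psi r]mulr1.
exact: (@apureZ R (calg phi) (calg psi)).
Qed.

Section Lift.
Variables (D : comPzRingType) (f : {rmorphism S -> D}) (g : {rmorphism T -> D}).
Hypothesis fg : forall r, f (phi r) = g (psi r).

Let h (s : calg phi) (t : calg psi) : D := f s * g t.
Let hDl s s' t : h (s + s') t = h s t + h s' t.
Proof. by rewrite /h rmorphD mulrDl. Qed.
Let hDr s t t' : h s (t + t') = h s t + h s t'.
Proof. by rewrite /h rmorphD mulrDr. Qed.
Let hZ r s t :
  h (ralg_map (calg phi) r * s) t = h s (ralg_map (calg psi) r * t).
Proof. by rewrite /h !rmorphM /= fg -mulrA mulrCA. Qed.

Definition clift : ctens -> D := atens_lift hDl hDr hZ.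

Lemma cliftE s t : clift (cpure s t) = f s * g t.
Proof. exact: (atens_liftE hDl hDr hZ). Qed.

Let clift_additive : nmod_morphism clift.
Proof.
by split=> [|x y]; [exact: (raddf0 (atens_lift hDl hDr hZ))
                   |exact: (raddfD (atens_lift hDl hDr hZ))].
Qed.
HB.instance Definition _ :=
  GRing.isNmodMorphism.Build ctens D clift clift_additive.

Let clift_monoid : monoid_morphism clift.
Proof.
split=> [|x y]; first by rewrite [1](_ : _ = cpure 1 1) // cliftE !rmorph1 mulr1.
elim/ctens_ind: x => [a b|x x' ex ey]; last first.
  by rewrite mulrDl !raddfD /= mulrDl ex ey.
elim/ctens_ind: y => [a' b'|y y' ex ey]; last first.
  by rewrite mulrDr !raddfD /= mulrDr ex ey.
by rewrite cpureM !cliftE !rmorphM mulrACA.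
Qed.
HB.instance Definition _ :=
  GRing.isMonoidMorphism.Build ctens D clift clift_monoid.

End Lift.

End CommutativeTensor.

Section AlgebraBaseChange.
Variables (R T : comPzRingType) (A : ralg R) (psi : {rmorphism R -> T}).

Let central t (x : atens A (calg psi)) :
  @ainr R A (calg psi) t * x = x * @ainr R A (calg psi) t.
Proof.
elim/atens_ind: x => [a b|x y ex ey]; last by rewrite mulrDl mulrDr ex ey.
by rewrite !apureM mulr1 mul1r; congr apure; exact: mulrC.
Qed.

Definition alg_base_change : ralg T :=
  @Ralg T (atens A (calg psi))
    (@ainr R A (calg psi) : {rmorphism calg psi -> atens A (calg psi)}) central.

End AlgebraBaseChange.

Section ModuleBaseChange.
Variables (A B : comPzRingType) (f : {rmorphism A -> B}) (M : lmodType A).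

Definition base_change : Type := tens M (restr f B^o).

HB.instance Definition _ := GRing.Zmodule.copy base_change (tens M (restr f B^o)).

Definition bpure (m : M) (b : B) : base_change := @pure A M (restr f B^o) m b.

Section Lift.
Variables (G : zmodType) (h : M -> B -> G).
Hypothesis (hDl : forall m m' b, h (m + m') b = h m b + h m' b).
Hypothesis (hDr : forall m b b', h m (b + b') = h m b + h m b').
Hypothesis (hZ : forall a m b, h (a *: m) b = h m (f a * b)).

Let h_balanced : @balanced A M (restr f B^o) G h.
Proof. by split=> *; [exact: hDl | exact: hDr | exact: hZ]. Qed.

Definition bc_lift : base_change -> G := tens_lift h_balanced.

HB.instance Definition _ := GRing.Additive.copy bc_lift (tens_lift h_balanced).

Lemma bc_liftE m b : bc_lift (bpure m b) = h m b.
Proof. exact: (tens_liftE h_balanced). Qed.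
End Lift.

Lemma bpureDl m m' b : bpure (m + m') b = bpure m b + bpure m' b.
Proof. exact: (@pureDl A M (restr f B^o)). Qed.
Lemma bpureDr m b b' : bpure m (b + b') = bpure m b + bpure m b'.
Proof. exact: (@pureDr A M (restr f B^o)). Qed.
Lemma bpureZ a m b : bpure (a *: m) b = bpure m (f a * b).
Proof. exact: (@pureZ A M (restr f B^o)). Qed.

Lemma bc_ind (P : base_change -> Prop) :
  (forall m b, P (bpure m b)) -> (forall x y, P x -> P y -> P (x + y)) ->
  forall x, P x.
Proof. exact: (@tens_ind A M (restr f B^o)). Qed.

Section Scale.
Variable c : B.
Let h (m : M) (b : B) : base_change := bpure m (c * b).
Let hDl m m' b : h (m + m') b = h m b + h m' b.
Proof. exact: bpureDl. Qed.
Let hDr m b b' : h m (b + b') = h m b + h m b'.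
Proof. by rewrite /h mulrDr bpureDr. Qed.
Let hZ a m b : h (a *: m) b = h m (f a * b).
Proof. by rewrite /h bpureZ mulrCA. Qed.
Definition bc_scale : base_change -> base_change := bc_lift hDl hDr hZ.
HB.instance Definition _ := GRing.Additive.on bc_scale.
Lemma bc_scaleE m b : bc_scale (bpure m b) = bpure m (c * b).
Proof. exact: bc_liftE. Qed.
End Scale.

Let bc_scaleA a b x : bc_scale a (bc_scale b x) = bc_scale (a * b) x.
Proof.
elim/bc_ind: x => [m c|x y ex ey]; last by rewrite !raddfD /= ex ey.
by rewrite !bc_scaleE mulrA.
Qed.
Let bc_scale1 : left_id 1 bc_scale.
Proof.
elim/bc_ind => [m c|x y ex ey]; last by rewrite !raddfD /= ex ey.
by rewrite !bc_scaleE mul1r.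
Qed.
Let bc_scaleDr : right_distributive bc_scale +%R.
Proof. by move=> a x y; rewrite raddfD. Qed.
Let bc_scaleDl x : {morph bc_scale^~ x : a b / a + b}.
Proof.
move=> a b; elim/bc_ind: x => [m c|x y ex ey].
  by rewrite !bc_scaleE mulrDl bpureDr.
by rewrite !raddfD /= ex ey addrACA.
Qed.

HB.instance Definition _ := GRing.Zmodule_isLmodule.Build B base_change
  bc_scaleA bc_scale1 bc_scaleDr bc_scaleDl.

Lemma scale_bpure c m b : c *: bpure m b = bpure m (c * b).
Proof. exact: bc_scaleE. Qed.

End ModuleBaseChange.

Section LinearMaps.
Variables (R : pzRingType) (U V : lmodType R).

Definition lhom : Type := {linear U -> V}.

HB.instance Definition _ := gen_eqMixin lhom.
HB.instance Definition _ := gen_choiceMixin lhom.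

Definition lhom_fun (f : lhom) : {linear U -> V} := f.
Coercion lhom_fun : lhom >-> GRing.Linear.type.

Lemma lhomP (f g : lhom) : f =1 g -> f = g.
Proof.
case: f g => [f [[fa] [fs]]] [g [[ga] [gs]]] /= e.
have {}e : f = g by apply/funext.
case: _ / e in ga gs *.
by rewrite (Prop_irrelevance fa ga) (Prop_irrelevance fs gs).
Qed.

Section Zmod.
Implicit Types f g : lhom.

Section Ops.
Variables f g : lhom.
Definition lhom_zero_fun (_ : U) : V := 0.
Definition lhom_add_fun (u : U) : V := f u + g u.
Definition lhom_opp_fun (u : U) : V := - f u.

Let zero_linear : linear lhom_zero_fun.
Proof. by move=> a u v; rewrite /lhom_zero_fun scaler0 addr0. Qed.
Let add_linear : linear lhom_add_fun.
Proof. by move=> a u v; rewrite /lhom_add_fun !linearP scalerDr addrACA. Qed.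
Let opp_linear : linear lhom_opp_fun.
Proof. by move=> a u v; rewrite /lhom_opp_fun linearP opprD scalerN. Qed.

HB.instance Definition _ := GRing.isLinear.Build R U V *:%R _ zero_linear.
HB.instance Definition _ := GRing.isLinear.Build R U V *:%R _ add_linear.
HB.instance Definition _ := GRing.isLinear.Build R U V *:%R _ opp_linear.

Definition lhom_zero : lhom := (lhom_zero_fun : {linear U -> V}).
Definition lhom_add : lhom := (lhom_add_fun : {linear U -> V}).
Definition lhom_opp : lhom := (lhom_opp_fun : {linear U -> V}).
End Ops.

Let lhom_addA : associative lhom_add.
Proof. by move=> f g h; apply: lhomP => u; exact: addrA. Qed.
Let lhom_addC : commutative lhom_add.
Proof. by move=> f g; apply: lhomP => u; exact: addrC. Qed.
Let lhom_add0 : left_id lhom_zero lhom_add.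
Proof. by move=> f; apply: lhomP => u; exact: add0r. Qed.
Let lhom_addN : left_inverse lhom_zero lhom_opp lhom_add.
Proof. by move=> f; apply: lhomP => u; exact: addNr. Qed.

HB.instance Definition _ :=
  GRing.isZmodule.Build lhom lhom_addA lhom_addC lhom_add0 lhom_addN.

Lemma lhomDE f g u : (f + g) u = f u + g u. Proof. by []. Qed.

End Zmod.

End LinearMaps.

Section Endomorphisms.
Variables (T : comPzRingType) (P : lmodType T).

Definition endo : Type := lhom P P.

HB.instance Definition _ := GRing.Zmodule.copy endo (lhom P P).

Definition endo_one : endo := (idfun : {linear P -> P}).
Definition endo_mul (f g : endo) : endo := (f \o g : {linear P -> P}).

Let endo_mulA : associative endo_mul.
Proof. by move=> f g h; apply: lhomP. Qed.
Let endo_mul1l : left_id endo_one endo_mul.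
Proof. by move=> f; apply: lhomP. Qed.
Let endo_mul1r : right_id endo_one endo_mul.
Proof. by move=> f; apply: lhomP. Qed.
Let endo_mulDl : left_distributive endo_mul +%R.
Proof. by move=> f g h; apply: lhomP. Qed.
Let endo_mulDr : right_distributive endo_mul +%R.
Proof. by move=> f g h; apply: lhomP => u; exact: raddfD. Qed.

HB.instance Definition _ := GRing.Zmodule_isPzRing.Build endo
  endo_mulA endo_mul1l endo_mul1r endo_mulDl endo_mulDr.

Definition homothety_fun (t : T) (p : P) : P := t *: p.
Let homothety_linear t : linear (homothety_fun t).
Proof.
by move=> a u v; rewrite /homothety_fun scalerDr !scalerA mulrC.
Qed.
HB.instance Definition _ t :=
  GRing.isLinear.Build T P P *:%R _ (homothety_linear t).
Definition homothety (t : T) : endo := (homothety_fun t : {linear P -> P}).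

Let homothety_additive : nmod_morphism homothety.
Proof.
split=> [|s t]; apply: lhomP => p; first exact: scale0r.
exact: scalerDl.
Qed.
Let homothety_monoid : monoid_morphism homothety.
Proof.
split=> [|s t]; apply: lhomP => p; first exact: scale1r.
by rewrite /= /homothety_fun scalerA.
Qed.
HB.instance Definition _ :=
  GRing.isNmodMorphism.Build T endo homothety homothety_additive.
HB.instance Definition _ :=
  GRing.isMonoidMorphism.Build T endo homothety homothety_monoid.

Let homothety_central t (f : endo) : homothety t * f = f * homothety t.
Proof. by apply: lhomP => p; rewrite /= /homothety_fun linearZ. Qed.

Definition End : ralg T := @Ralg T endo homothety homothety_central.

End Endomorphisms.

Definition azumaya (R : comPzRingType) (A : ralg R) : Prop :=
  exists (T : comPzRingType) (psi : {rmorphism R -> T}) (P : lmodType T),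
    [/\ faithfully_flat (restr psi T^o),
        faithfully_projective P
      & alg_iso (alg_base_change A psi) (End P)].

(* Equality of the classes of A and B in the Brauer group. *)
Definition brauer_equiv (R : comPzRingType) (A B : ralg R) : Prop :=
  exists P Q : lmodType R,
    [/\ faithfully_projective P, faithfully_projective Q
      & alg_iso (atensor A (End P)) (atensor B (End Q))].

(* The class of A lies in the kernel of Br(R) -> Br(S), that is, A (x) S has the
   class of S, the neutral element of Br(S). *)
Definition split_by (R S : comPzRingType) (phi : {rmorphism R -> S})
    (A : ralg R) : Prop :=
  brauer_equiv (alg_base_change A phi) (calg (idfun : {rmorphism S -> S})).

Section TensorPowers.
Variables (R S : comPzRingType) (phi : {rmorphism R -> S}).

Definition S2 : comPzRingType := ctens phi phi.
Definition inl2 : {rmorphism S -> S2} := cinl phi phi.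
Definition inr2 : {rmorphism S -> S2} := cinr phi phi.
Definition mul2 : {rmorphism S2 -> S} :=
  @clift R S S phi phi S idfun idfun (fun _ => erefl).

Lemma mul2l s : mul2 (inl2 s) = s.
Proof. by rewrite /mul2 [LHS]cliftE rmorph1 mulr1. Qed.
Lemma mul2r s : mul2 (inr2 s) = s.
Proof. by rewrite /mul2 [LHS]cliftE rmorph1 mul1r. Qed.

Lemma S2_ind (P : S2 -> Prop) :
  (forall s t, P (inl2 s * inr2 t)) -> (forall x y, P x -> P y -> P (x + y)) ->
  forall x, P x.
Proof.
move=> Pp; apply: ctens_ind => s t.
by move: (Pp s t); rewrite cpureM mulr1 mul1r.
Qed.

Definition phi2 : {rmorphism R -> S2} := inl2 \o phi.

Definition S3 : comPzRingType := ctens phi2 phi.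
Definition in1 : {rmorphism S -> S3} := cinl phi2 phi \o inl2.
Definition in2 : {rmorphism S -> S3} := cinl phi2 phi \o inr2.
Definition in3 : {rmorphism S -> S3} := cinr phi2 phi.

Let in12 r : in1 (phi r) = in2 (phi r).
Proof. by rewrite /= -[inr2 _](@cin_base R S S phi phi r). Qed.
Let in13 r : in1 (phi r) = in3 (phi r).
Proof. exact: (@cin_base R S2 S phi2 phi r). Qed.
Let in23 r : in2 (phi r) = in3 (phi r).
Proof. by rewrite -in12 in13. Qed.

Definition eta1 : {rmorphism S2 -> S3} := clift in23.
Definition eta2 : {rmorphism S2 -> S3} := clift in13.
Definition eta3 : {rmorphism S2 -> S3} := clift in12.

Lemma eta1E s t : eta1 (cpure phi phi s t) = cpure phi2 phi (cpure phi phi 1 s) t.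
Proof. by rewrite /eta1 [LHS]cliftE [LHS]cpureM mulr1 mul1r. Qed.
Lemma eta2E s t : eta2 (cpure phi phi s t) = cpure phi2 phi (cpure phi phi s 1) t.
Proof. by rewrite /eta2 [LHS]cliftE [LHS]cpureM mulr1 mul1r. Qed.
Lemma eta3E s t : eta3 (cpure phi phi s t) = cpure phi2 phi (cpure phi phi s t) 1.
Proof. by rewrite /eta3 [LHS]cliftE [LHS]cpureM mulr1 cpureM mulr1 mul1r. Qed.

Lemma eta1l s : eta1 (inl2 s) = in2 s.
Proof. by rewrite /eta1 [LHS]cliftE rmorph1 mulr1. Qed.
Lemma eta1r s : eta1 (inr2 s) = in3 s.
Proof. by rewrite /eta1 [LHS]cliftE rmorph1 mul1r. Qed.
Lemma eta2l s : eta2 (inl2 s) = in1 s.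
Proof. by rewrite /eta2 [LHS]cliftE rmorph1 mulr1. Qed.
Lemma eta2r s : eta2 (inr2 s) = in3 s.
Proof. by rewrite /eta2 [LHS]cliftE rmorph1 mul1r. Qed.
Lemma eta3l s : eta3 (inl2 s) = in1 s.
Proof. by rewrite /eta3 [LHS]cliftE rmorph1 mulr1. Qed.
Lemma eta3r s : eta3 (inr2 s) = in2 s.
Proof. by rewrite /eta3 [LHS]cliftE rmorph1 mul1r. Qed.

(* The S-bimodule C (x)_S D, as an S (x) S-module: the tensor product over S
   uses the right action on C and the left action on D, while (s (x) t) acts
   by s on the left of C and by t on the right of D. *)
Section BimoduleTensor.
Variables C D : lmodType S2.

Definition cotens : Type := tens (restr inr2 C) (restr inl2 D).

HB.instance Definition _ :=
  GRing.Zmodule.copy cotens (tens (restr inr2 C) (restr inl2 D)).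

Definition copure (c : C) (d : D) : cotens :=
  @pure S (restr inr2 C) (restr inl2 D) c d.

Lemma copureDl c c' d : copure (c + c') d = copure c d + copure c' d.
Proof. exact: (@pureDl S (restr inr2 C) (restr inl2 D)). Qed.
Lemma copureDr c d d' : copure c (d + d') = copure c d + copure c d'.
Proof. exact: (@pureDr S (restr inr2 C) (restr inl2 D)). Qed.
Lemma copureZ s c d : copure (inr2 s *: c) d = copure c (inl2 s *: d).
Proof. exact: (@pureZ S (restr inr2 C) (restr inl2 D)). Qed.

Lemma cotens_ind (P : cotens -> Prop) :
  (forall c d, P (copure c d)) -> (forall x y, P x -> P y -> P (x + y)) ->
  forall x, P x.
Proof. exact: (@tens_ind S (restr inr2 C) (restr inl2 D)). Qed.

Section Lift.
Variables (G : zmodType) (h : C -> D -> G).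
Hypothesis (hDl : forall c c' d, h (c + c') d = h c d + h c' d).
Hypothesis (hDr : forall c d d', h c (d + d') = h c d + h c d').
Hypothesis (hZ : forall s c d, h (inr2 s *: c) d = h c (inl2 s *: d)).

Let h_balanced : @balanced S (restr inr2 C) (restr inl2 D) G h.
Proof. by split=> *; [exact: hDl | exact: hDr | exact: hZ]. Qed.

Definition colift : cotens -> G := tens_lift h_balanced.

HB.instance Definition _ := GRing.Additive.copy colift (tens_lift h_balanced).

Lemma coliftE c d : colift (copure c d) = h c d.
Proof. exact: (tens_liftE h_balanced). Qed.
End Lift.

Section Action.
Variables s t : S.
Let h (c : C) (d : D) : cotens := copure (inl2 s *: c) (inr2 t *: d).
Let hDl c c' d : h (c + c') d = h c d + h c' d.
Proof. by rewrite /h scalerDr copureDl. Qed.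
Let hDr c d d' : h c (d + d') = h c d + h c d'.
Proof. by rewrite /h scalerDr copureDr. Qed.
Let hZ r c d : h (inr2 r *: c) d = h c (inl2 r *: d).
Proof. by rewrite /h scalerA mulrC -scalerA copureZ !scalerA mulrC. Qed.

Definition bimod_act : cotens -> cotens := colift hDl hDr hZ.

HB.instance Definition _ := GRing.Additive.on bimod_act.

Lemma bimod_actE c d :
  bimod_act (copure c d) = copure (inl2 s *: c) (inr2 t *: d).
Proof. exact: coliftE. Qed.
End Action.

Let bimod_actDl (s s' : calg phi) (t : calg phi) :
  bimod_act (s + s') t = bimod_act s t + bimod_act s' t.
Proof.
apply/funext; elim/cotens_ind => [c d|x y ex ey].
  by rewrite addrfctE !bimod_actE rmorphD scalerDl copureDl.
by move: ex ey; rewrite !addrfctE !raddfD /= => -> ->; rewrite addrACA.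
Qed.
Let bimod_actDr (s : calg phi) (t t' : calg phi) :
  bimod_act s (t + t') = bimod_act s t + bimod_act s t'.
Proof.
apply/funext; elim/cotens_ind => [c d|x y ex ey].
  by rewrite addrfctE !bimod_actE rmorphD scalerDl copureDr.
by move: ex ey; rewrite !addrfctE !raddfD /= => -> ->; rewrite addrACA.
Qed.
Let bimod_actZ r (s t : calg phi) :
  bimod_act (ralg_map (calg phi) r * s) t =
  bimod_act s (ralg_map (calg phi) r * t).
Proof.
apply/funext; elim/cotens_ind => [c d|x y ex ey]; last first.
  by rewrite !raddfD /= ex ey.
rewrite !bimod_actE !rmorphM -!scalerA /=.
rewrite [inl2 (phi r)](@cin_base R S S phi phi r) copureZ.
by rewrite [inl2 (phi r)](@cin_base R S S phi phi r).
Qed.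

Definition cotens_scale (x : S2) : cotens -> cotens :=
  atens_lift bimod_actDl bimod_actDr bimod_actZ x.

Let cotens_scale_pure s t z :
  cotens_scale (inl2 s * inr2 t) z = bimod_act s t z.
Proof.
rewrite /cotens_scale [_ * _]cpureM mulr1 mul1r.
by rewrite /cpure atens_liftE.
Qed.
Let cotens_scaleDl z : {morph cotens_scale^~ z : x y / x + y}.
Proof. by move=> x y; rewrite /cotens_scale raddfD. Qed.
Let cotens_scaleDr : right_distributive cotens_scale +%R.
Proof.
move=> x z w; elim/S2_ind: x => [s t|x y ex ey].
  by rewrite !cotens_scale_pure raddfD.
by rewrite !cotens_scaleDl ex ey addrACA.
Qed.
Let cotens_scaleA x y z :
  cotens_scale x (cotens_scale y z) = cotens_scale (x * y) z.
Proof.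
elim/S2_ind: x => [s t|x x' ex ey]; last first.
  by rewrite mulrDl !cotens_scaleDl ex ey.
elim/S2_ind: y => [s' t'|y y' ex ey]; last first.
  by rewrite mulrDr !cotens_scaleDl cotens_scaleDr ex ey.
rewrite mulrACA -!rmorphM !cotens_scale_pure.
elim/cotens_ind: z => [c d|z z' ex ey]; last by rewrite !raddfD /= ex ey.
by rewrite !bimod_actE !scalerA !rmorphM.
Qed.
Let cotens_scale1 : left_id 1 cotens_scale.
Proof.
have -> : 1 = inl2 1 * inr2 1 by rewrite !rmorph1 mulr1.
move=> z; rewrite cotens_scale_pure.
elim/cotens_ind: z => [c d|z z' ex ey]; last by rewrite !raddfD /= ex ey.
by rewrite bimod_actE !rmorph1 !scale1r.
Qed.

HB.instance Definition _ := GRing.Zmodule_isLmodule.Build S2 cotens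
  cotens_scaleA cotens_scale1 cotens_scaleDr cotens_scaleDl.

Lemma scale_copure s t c d :
  (inl2 s * inr2 t) *: copure c d = copure (inl2 s *: c) (inr2 t *: d).
Proof. by rewrite [LHS]cotens_scale_pure bimod_actE. Qed.
Lemma scalel_copure s c d : inl2 s *: copure c d = copure (inl2 s *: c) d.
Proof. by rewrite -[inl2 s]mulr1 -(rmorph1 inr2) scale_copure !rmorph1 mulr1 scale1r. Qed.
Lemma scaler_copure s c d : inr2 s *: copure c d = copure c (inr2 s *: d).
Proof. by rewrite -[inr2 s]mul1r -(rmorph1 inl2) scale_copure !rmorph1 mul1r scale1r. Qed.

End BimoduleTensor.

Section BimoduleTensorMap.
Variables (C C' D D' : lmodType S2).
Variables (f : {linear C -> C'}) (g : {linear D -> D'}).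

Let h c d : cotens C' D' := copure (f c) (g d).
Let hDl c c' d : h (c + c') d = h c d + h c' d.
Proof. by rewrite /h linearD copureDl. Qed.
Let hDr c d d' : h c (d + d') = h c d + h c d'.
Proof. by rewrite /h linearD copureDr. Qed.
Let hZ s c d : h (inr2 s *: c) d = h c (inl2 s *: d).
Proof. by rewrite /h !linearZ /= copureZ. Qed.

Definition cotmap : cotens C D -> cotens C' D' := colift hDl hDr hZ.

HB.instance Definition _ := GRing.Additive.on cotmap.

Lemma cotmapE c d : cotmap (copure c d) = copure (f c) (g d).
Proof. exact: coliftE. Qed.

End BimoduleTensorMap.

Section Associator.
Variables C D E : lmodType S2.

Section Inner.
Variable e : E.
Let h c d : cotens C (cotens D E) := copure c (copure d e).
Let hDl c c' d : h (c + c') d = h c d + h c' d.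
Proof. exact: copureDl. Qed.
Let hDr c d d' : h c (d + d') = h c d + h c d'.
Proof. by rewrite /h copureDl copureDr. Qed.
Let hZ s c d : h (inr2 s *: c) d = h c (inl2 s *: d).
Proof. by rewrite /h copureZ scalel_copure. Qed.
Definition assoc_inner : cotens C D -> cotens C (cotens D E) :=
  colift hDl hDr hZ.
HB.instance Definition _ := GRing.Additive.on assoc_inner.
Lemma assoc_innerE c d : assoc_inner (copure c d) = copure c (copure d e).
Proof. exact: coliftE. Qed.
End Inner.

Let h (w : cotens C D) (e : E) := assoc_inner e w.
Let hDl w w' e : h (w + w') e = h w e + h w' e.
Proof. by rewrite /h raddfD. Qed.
Let hDr w e e' : h w (e + e') = h w e + h w e'.
Proof.
rewrite /h; elim/cotens_ind: w => [c d|x y ex ey].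
  by rewrite !assoc_innerE !copureDr.
by rewrite !raddfD /= ex ey addrACA.
Qed.
Let hZ s w e : h (inr2 s *: w) e = h w (inl2 s *: e).
Proof.
rewrite /h; elim/cotens_ind: w => [c d|x y ex ey].
  by rewrite scaler_copure !assoc_innerE copureZ.
by rewrite scalerDr !raddfD /= ex ey.
Qed.

Definition cotens_assoc : cotens (cotens C D) E -> cotens C (cotens D E) :=
  colift hDl hDr hZ.

HB.instance Definition _ := GRing.Additive.on cotens_assoc.

Lemma cotens_assocE c d e :
  cotens_assoc (copure (copure c d) e) = copure c (copure d e).
Proof. by rewrite /cotens_assoc coliftE /h assoc_innerE. Qed.

End Associator.

Definition Sbimod : lmodType S2 := restr mul2 S^o.

Definition left_hom (C : lmodType S2) : Type := lhom (restr inl2 C) S^o.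
Definition right_hom (C : lmodType S2) : Type := lhom (restr inr2 C) S^o.

HB.instance Definition _ C :=
  GRing.Zmodule.copy (left_hom C) (lhom (restr inl2 C) S^o).
HB.instance Definition _ C :=
  GRing.Zmodule.copy (right_hom C) (lhom (restr inr2 C) S^o).

Section Contraction.
Variable C : lmodType S2.

Definition left_fun (g : left_hom C) (c : C) : S := (g : lhom _ _) c.
Definition right_fun (f : right_hom C) (c : C) : S := (f : lhom _ _) c.
Coercion left_fun : left_hom >-> Funclass.
Coercion right_fun : right_hom >-> Funclass.

Lemma left_homD (g : left_hom C) c d : g (c + d) = g c + g d.
Proof. exact: (raddfD (g : lhom (restr inl2 C) S^o)). Qed.
Lemma left_homZ (g : left_hom C) s c : g (inl2 s *: c) = s * g c.
Proof. exact: (linearZ_LR (g : lhom (restr inl2 C) S^o)). Qed.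
Lemma right_homD (f : right_hom C) c d : f (c + d) = f c + f d.
Proof. exact: (raddfD (f : lhom (restr inr2 C) S^o)). Qed.
Lemma right_homZ (f : right_hom C) s c : f (inr2 s *: c) = s * f c.
Proof. exact: (linearZ_LR (f : lhom (restr inr2 C) S^o)). Qed.

Lemma left_homP (f g : left_hom C) : f =1 g -> f = g.
Proof. exact: (@lhomP S (restr inl2 C) S^o f g). Qed.
Lemma right_homP (f g : right_hom C) : f =1 g -> f = g.
Proof. exact: (@lhomP S (restr inr2 C) S^o f g). Qed.

Section Mk.
Variable f : C -> S.
Hypothesis fD : forall c d, f (c + d) = f c + f d.

Section Left.
Hypothesis fZ : forall s c, f (inl2 s *: c) = s * f c.
Definition mk_left_fun (c : restr inl2 C) : S^o := let _ := (fD, fZ) in f c.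
Let mk_left_linear : linear mk_left_fun.
Proof. by move=> a u v; rewrite /mk_left_fun fD; congr (_ + _); exact: fZ. Qed.
HB.instance Definition _ :=
  GRing.isLinear.Build S (restr inl2 C) S^o *:%R _ mk_left_linear.
Definition mk_left : left_hom C := (mk_left_fun : {linear restr inl2 C -> S^o}).
End Left.

Section Right.
Hypothesis fZ : forall s c, f (inr2 s *: c) = s * f c.
Definition mk_right_fun (c : restr inr2 C) : S^o := let _ := (fD, fZ) in f c.
Let mk_right_linear : linear mk_right_fun.
Proof. by move=> a u v; rewrite /mk_right_fun fD; congr (_ + _); exact: fZ. Qed.
HB.instance Definition _ :=
  GRing.isLinear.Build S (restr inr2 C) S^o *:%R _ mk_right_linear.
Definition mk_right : right_hom C :=
  (mk_right_fun : {linear restr inr2 C -> S^o}).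
End Right.
End Mk.

Section ContractRight.
Variable g : left_hom C.
Let h c d : C := inr2 (g d) *: c.
Let hDl c c' d : h (c + c') d = h c d + h c' d.
Proof. exact: scalerDr. Qed.
Let hDr c d d' : h c (d + d') = h c d + h c d'.
Proof. by rewrite /h left_homD rmorphD scalerDl. Qed.
Let hZ s c d : h (inr2 s *: c) d = h c (inl2 s *: d).
Proof. by rewrite /h left_homZ rmorphM scalerA mulrC. Qed.
Definition contract_right : cotens C C -> C := colift hDl hDr hZ.
HB.instance Definition _ := GRing.Additive.on contract_right.
Lemma contract_rightE c d : contract_right (copure c d) = inr2 (g d) *: c.
Proof. exact: coliftE. Qed.
Lemma contract_rightZ s z :
  contract_right (inl2 s *: z) = inl2 s *: contract_right z.
Proof.
elim/cotens_ind: z => [c d|x y ex ey]; last first.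
  by rewrite scalerDr !(raddfD contract_right) /= ex ey scalerDr.
by rewrite scalel_copure !contract_rightE !scalerA mulrC.
Qed.
End ContractRight.

Section ContractLeft.
Variable f : right_hom C.
Let h c d : C := inl2 (f c) *: d.
Let hDl c c' d : h (c + c') d = h c d + h c' d.
Proof. by rewrite /h right_homD rmorphD scalerDl. Qed.
Let hDr c d d' : h c (d + d') = h c d + h c d'.
Proof. exact: scalerDr. Qed.
Let hZ s c d : h (inr2 s *: c) d = h c (inl2 s *: d).
Proof. by rewrite /h right_homZ rmorphM scalerA mulrC. Qed.
Definition contract_left : cotens C C -> C := colift hDl hDr hZ.
HB.instance Definition _ := GRing.Additive.on contract_left.
Lemma contract_leftE c d : contract_left (copure c d) = inl2 (f c) *: d.
Proof. exact: coliftE. Qed.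
Lemma contract_leftZ s z :
  contract_left (inr2 s *: z) = inr2 s *: contract_left z.
Proof.
elim/cotens_ind: z => [c d|x y ex ey]; last first.
  by rewrite scalerDr !(raddfD contract_left) /= ex ey scalerDr.
by rewrite scaler_copure !contract_leftE !scalerA mulrC.
Qed.
End ContractLeft.

Section BimoduleMap.
Variable e : {linear C -> Sbimod}.
Let eD c d : e (c + d) = e c + e d. Proof. exact: raddfD. Qed.
Let eZl s c : e (inl2 s *: c) = s * e c.
Proof. by rewrite linearZ /= [LHS]restrE mul2l. Qed.
Let eZr s c : e (inr2 s *: c) = s * e c.
Proof. by rewrite linearZ /= [LHS]restrE mul2r. Qed.
Definition bimod_left : left_hom C := mk_left eD eZl.
Definition bimod_right : right_hom C := mk_right eD eZr.
End BimoduleMap.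

End Contraction.

End TensorPowers.

Record coring (R S : comPzRingType) (phi : {rmorphism R -> S}) := Coring {
  coring_mod :> lmodType (S2 phi);
  comul : {linear coring_mod -> cotens coring_mod coring_mod};
  counit : {linear coring_mod -> Sbimod phi};
  comulA : forall c, cotens_assoc (cotmap comul idfun (comul c)) =
                     cotmap idfun comul (comul c);
  counitl : forall c, contract_left (bimod_right counit) (comul c) = c;
  counitr : forall c, contract_right (bimod_left counit) (comul c) = c
}.

Section AzumayaCoring.
Variables (R S : comPzRingType) (phi : {rmorphism R -> S}) (C : coring phi).

Definition C1 : lmodType (S3 phi) := base_change (eta1 phi) C.
Definition C2 : lmodType (S3 phi) := base_change (eta2 phi) C.
Definition C3 : lmodType (S3 phi) := base_change (eta3 phi) C.

Let h (c d : C) : tens C3 C1 :=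
  @pure _ C3 C1 (bpure (eta3 phi) c 1) (bpure (eta1 phi) d 1).
Let hDl c c' d : h (c + c') d = h c d + h c' d.
Proof. by rewrite /h bpureDl pureDl. Qed.
Let hDr c d d' : h c (d + d') = h c d + h c d'.
Proof. by rewrite /h bpureDl pureDr. Qed.
Let hZ s c d : h (inr2 phi s *: c) d = h c (inl2 phi s *: d).
Proof.
by rewrite /h !bpureZ eta3r eta1l -scale_bpure pureZ scale_bpure.
Qed.

Definition kappa : cotens C C -> tens C3 C1 := colift hDl hDr hZ.

HB.instance Definition _ := GRing.Additive.on kappa.

Lemma kappaE c d : kappa (copure c d) =
  @pure _ C3 C1 (bpure (eta3 phi) c 1) (bpure (eta1 phi) d 1).
Proof. exact: coliftE. Qed.

Lemma kappaZ x z : kappa (x *: z) = eta2 phi x *: kappa z.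
Proof.
elim/S2_ind: x => [s t|x y ex ey]; last first.
  by rewrite scalerDl rmorphD (raddfD kappa) /= ex ey scalerDl.
elim/cotens_ind: z => [c d|x y ex ey]; last first.
  by rewrite scalerDr !(raddfD kappa) /= ex ey scalerDr.
rewrite scale_copure !kappaE !bpureZ eta3l eta1r.
rewrite rmorphM eta2l eta2r -!scale_bpure.
by rewrite -pureZ -[RHS]scalerA !scale_pure scalerA mulrC -scalerA.
Qed.

Let k (c : C) (x : S3 phi) : tens C3 C1 := x *: kappa (comul C c).
Let kDl c c' x : k (c + c') x = k c x + k c' x.
Proof. by rewrite /k linearD raddfD scalerDr. Qed.
Let kDr c x x' : k c (x + x') = k c x + k c x'.
Proof. exact: scalerDl. Qed.
Let kZ a c x : k (a *: c) x = k c (eta2 phi a * x).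
Proof. by rewrite /k linearZ kappaZ scalerA mulrC. Qed.

(* The S3-linear map c_2 |-> c_(1)3 (x) c_(2)1, see [kappaE] and [tdeltaE]. *)
Definition tdelta : C2 -> tens C3 C1 := bc_lift kDl kDr kZ.

HB.instance Definition _ := GRing.Additive.on tdelta.

Lemma tdeltaE c x : tdelta (bpure (eta2 phi) c x) = x *: kappa (comul C c).
Proof. exact: bc_liftE. Qed.

Let tdelta_scalable : scalable tdelta.
Proof.
move=> a; elim/bc_ind => [c x|x y ex ey].
  by rewrite [a *: _]scale_bpure !tdeltaE scalerA.
by rewrite scalerDr !(raddfD tdelta) /= ex ey scalerDr.
Qed.
HB.instance Definition _ :=
  GRing.isScalable.Build (S3 phi) C2 (tens C3 C1) *:%R tdelta tdelta_scalable.

End AzumayaCoring.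

(* Faithful flatness of S over R is not repeated here: it follows from S being
   faithfully projective over R. *)
Definition azumaya_coring (R S : comPzRingType) (phi : {rmorphism R -> S})
    (C : coring phi) : Prop :=
  faithfully_projective (coring_mod C) /\ bijective (tdelta (C := C)).

Section DualAlgebras.
Variables (R S : comPzRingType) (phi : {rmorphism R -> S}) (C : coring phi).
Local Notation inl2 := (inl2 phi).
Local Notation inr2 := (inr2 phi).
Local Notation comul := (comul C).
Local Notation counit := (counit C).

Let inE r : inl2 (phi r) = inr2 (phi r).
Proof. exact: (@cin_base R S S phi phi r). Qed.

Let counitD c d : counit (c + d) = counit c + counit d.
Proof. exact: raddfD. Qed.

(* With Delta(c) = c_(1) (x) c_(2): shift_right g c = c_(1) g(c_(2)) and
   shift_left f c = f(c_(1)) c_(2). *)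
Definition shift_right (g : left_hom C) (c : C) : C := contract_right g (comul c).
Definition shift_left (f : right_hom C) (c : C) : C := contract_left f (comul c).

Section ShiftRight.
Variable g : left_hom C.
Lemma shift_rightD c d : shift_right g (c + d) = shift_right g c + shift_right g d.
Proof. by rewrite /shift_right linearD raddfD. Qed.
Lemma shift_rightZ s c : shift_right g (inl2 s *: c) = inl2 s *: shift_right g c.
Proof. by rewrite /shift_right linearZ contract_rightZ. Qed.
End ShiftRight.

Section ShiftLeft.
Variable f : right_hom C.
Lemma shift_leftD c d : shift_left f (c + d) = shift_left f c + shift_left f d.
Proof. by rewrite /shift_left linearD raddfD. Qed.
Lemma shift_leftZ s c : shift_left f (inr2 s *: c) = inr2 s *: shift_left f c.
Proof. by rewrite /shift_left linearZ contract_leftZ. Qed.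
End ShiftLeft.

Let crD g x y : contract_right g (x + y) = contract_right g x + contract_right g y :> C.
Proof. exact: raddfD. Qed.
Let clD g x y : contract_left g (x + y) = contract_left g x + contract_left g y :> C.
Proof. exact: raddfD. Qed.

Lemma left_homDE (f g : left_hom C) c :
  left_fun (f + g) c = left_fun f c + left_fun g c.
Proof. by []. Qed.
Lemma right_homDE (f g : right_hom C) c :
  right_fun (f + g) c = right_fun f c + right_fun g c.
Proof. by []. Qed.

Lemma shift_right_add (g g' : left_hom C) c :
  shift_right (g + g') c = shift_right g c + shift_right g' c.
Proof.
rewrite /shift_right; elim/cotens_ind: (comul c) => [a b|x y ex ey].
  by rewrite !contract_rightE left_homDE rmorphD scalerDl.
by rewrite !crD ex ey addrACA.
Qed.
Lemma shift_left_add (g g' : right_hom C) c :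
  shift_left (g + g') c = shift_left g c + shift_left g' c.
Proof.
rewrite /shift_left; elim/cotens_ind: (comul c) => [a b|x y ex ey].
  by rewrite !contract_leftE right_homDE rmorphD scalerDl.
by rewrite !clD ex ey addrACA.
Qed.

Section LeftMul.
Variables g f : left_hom C.
Let h c := f (shift_right g c).
Let hD c d : h (c + d) = h c + h d.
Proof. by rewrite /h shift_rightD left_homD. Qed.
Let hZ s c : h (inl2 s *: c) = s * h c.
Proof. by rewrite /h shift_rightZ left_homZ. Qed.
(* g # f : c |-> f(c_(1) g(c_(2))) *)
Definition left_mul : left_hom C := mk_left hD hZ.
Lemma left_mulE c : left_mul c = f (shift_right g c). Proof. by []. Qed.
End LeftMul.

Section RightMul.
Variables f g : right_hom C.
Let h c := f (shift_left g c).
Let hD c d : h (c + d) = h c + h d.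
Proof. by rewrite /h shift_leftD right_homD. Qed.
Let hZ s c : h (inr2 s *: c) = s * h c.
Proof. by rewrite /h shift_leftZ right_homZ. Qed.
(* f # g : c |-> f(g(c_(1)) c_(2)) *)
Definition right_mul : right_hom C := mk_right hD hZ.
Lemma right_mulE c : right_mul c = f (shift_left g c). Proof. by []. Qed.
End RightMul.

Section ShiftRightMul.
Variables g h : left_hom C.
Let p (c : C) (w : cotens C C) : C := inr2 (g (contract_right h w)) *: c.
Let pDl c c' w : p (c + c') w = p c w + p c' w.
Proof. exact: scalerDr. Qed.
Let pDr c w w' : p c (w + w') = p c w + p c w'.
Proof. by rewrite /p raddfD left_homD rmorphD scalerDl. Qed.
Let pZ s c w : p (inr2 s *: c) w = p c (inl2 s *: w).
Proof. by rewrite /p contract_rightZ left_homZ rmorphM scalerA mulrC. Qed.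
Let psi : cotens C (cotens C C) -> C := colift pDl pDr pZ.
HB.instance Definition _ := GRing.Additive.on psi.
Let psiE c w : psi (copure c w) = p c w.
Proof. exact: coliftE. Qed.

Lemma shift_right_mul c :
  shift_right g (shift_right h c) = shift_right (left_mul h g) c.
Proof.
transitivity (psi (cotens_assoc (cotmap comul idfun (comul c)))).
  rewrite {1}/shift_right [X in comul X]/shift_right.
  elim/cotens_ind: (comul c) => [a d|x y ex ey]; last first.
    by rewrite (raddfD (contract_right h)) linearD !raddfD /= ex ey.
  rewrite contract_rightE linearZ cotmapE /=.
  elim/cotens_ind: (comul a) => [a' b|x y ex ey]; last first.
    by rewrite scalerDr !raddfD /= ex ey copureDl !raddfD.
  by rewrite scaler_copure cotens_assocE psiE contract_rightE /p contract_rightE.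
rewrite comulA /shift_right.
elim/cotens_ind: (comul c) => [a d|x y ex ey]; last by rewrite !raddfD /= ex ey.
by rewrite cotmapE psiE contract_rightE.
Qed.
End ShiftRightMul.

Section ShiftLeftMul.
Variables g h : right_hom C.
Let p (c : C) (w : cotens C C) : C := contract_left g (inl2 (h c) *: w).
Let pDl c c' w : p (c + c') w = p c w + p c' w.
Proof. by rewrite /p right_homD rmorphD scalerDl raddfD. Qed.
Let pDr c w w' : p c (w + w') = p c w + p c w'.
Proof. by rewrite /p scalerDr raddfD. Qed.
Let pZ s c w : p (inr2 s *: c) w = p c (inl2 s *: w).
Proof. by rewrite /p right_homZ rmorphM scalerA mulrC. Qed.
Let psi : cotens C (cotens C C) -> C := colift pDl pDr pZ.
HB.instance Definition _ := GRing.Additive.on psi.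
Let psiE c w : psi (copure c w) = p c w.
Proof. exact: coliftE. Qed.

Lemma shift_left_mul c :
  shift_left g (shift_left h c) = shift_left (right_mul g h) c.
Proof.
transitivity (psi (cotmap idfun comul (comul c))).
  rewrite {1}/shift_left [X in comul X]/shift_left.
  elim/cotens_ind: (comul c) => [a d|x y ex ey]; last first.
    by rewrite (raddfD (contract_left h)) linearD !raddfD /= ex ey.
  by rewrite contract_leftE linearZ cotmapE psiE.
rewrite -comulA /shift_left.
elim/cotens_ind: (comul c) => [a d|x y ex ey]; last by rewrite !raddfD /= ex ey.
rewrite cotmapE contract_leftE right_mulE /shift_left /=.
elim/cotens_ind: (comul a) => [a' b|x y ex ey]; last first.
  by rewrite copureDl !raddfD /= ex ey right_homD rmorphD scalerDl.
by rewrite cotens_assocE psiE /p scalel_copure !contract_leftE.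
Qed.
End ShiftLeftMul.

Section Left.

Definition lHom : Type := left_hom C.
HB.instance Definition _ := GRing.Zmodule.copy lHom (left_hom C).

Definition lHom_mul (g f : lHom) : lHom := left_mul g f.
Definition lHom_one : lHom := bimod_left counit.

Let shift_right1 c : shift_right lHom_one c = c.
Proof. exact: counitr. Qed.

Let lmulA : associative lHom_mul.
Proof.
move=> h g f; apply: left_homP => c.
by rewrite !left_mulE shift_right_mul.
Qed.
Let lmul1l : left_id lHom_one lHom_mul.
Proof. by move=> f; apply: left_homP => c; rewrite left_mulE shift_right1. Qed.
Let lmul1r : right_id lHom_one lHom_mul.
Proof.
move=> g; apply: left_homP => c; rewrite left_mulE.
rewrite -[in RHS](counitl c) /shift_right.
elim/cotens_ind: (comul c) => [a b|x y ex ey].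
  rewrite contract_rightE contract_leftE left_homZ.
  rewrite -[LHS]/((bimod_right counit : right_hom C) _) right_homZ.
  by rewrite mulrC.
by rewrite crD clD !left_homD ex ey.
Qed.
Let lmulDl : left_distributive lHom_mul +%R.
Proof.
move=> g g' f; apply: left_homP => c.
by rewrite left_homDE !left_mulE shift_right_add left_homD.
Qed.
Let lmulDr : right_distributive lHom_mul +%R.
Proof. by move=> g f f'; apply: left_homP => c. Qed.

HB.instance Definition _ := GRing.Zmodule_isPzRing.Build lHom
  lmulA lmul1l lmul1r lmulDl lmulDr.

Definition lHom_map_fun (r : R) (c : C) : S := phi r * left_fun lHom_one c.
Let lmapD r c d : lHom_map_fun r (c + d) = lHom_map_fun r c + lHom_map_fun r d.
Proof. by rewrite /lHom_map_fun left_homD mulrDr. Qed.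
Let lmapZ r s c : lHom_map_fun r (inl2 s *: c) = s * lHom_map_fun r c.
Proof. by rewrite /lHom_map_fun left_homZ mulrCA. Qed.
Definition lHom_map (r : R) : lHom := mk_left (lmapD r) (lmapZ r).

Let lmap_mulr r (g : lHom) c : left_fun (g * lHom_map r) c = phi r * left_fun g c.
Proof. by rewrite -[in RHS](mulr1 g). Qed.
Let lmap_mull r (g : lHom) c : left_fun (lHom_map r * g) c = phi r * left_fun g c.
Proof.
rewrite [LHS]left_mulE.
suff -> : shift_right (lHom_map r) c = inl2 (phi r) *: c by rewrite left_homZ.
rewrite -[in RHS](shift_right1 c) -contract_rightZ inE /shift_right.
elim/cotens_ind: (comul c) => [a b|x y ex ey].
  rewrite -inE scalel_copure !contract_rightE inE scalerA.
  by rewrite -rmorphM mulrC.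
by rewrite scalerDr !crD ex ey.
Qed.

Let lmap_additive : nmod_morphism lHom_map.
Proof.
split=> [|r r']; apply: left_homP => c.
  by rewrite /left_fun /= /mk_left_fun /lHom_map_fun rmorph0 mul0r.
by rewrite left_homDE -[LHS]/(lHom_map_fun _ _) /lHom_map_fun rmorphD mulrDl.
Qed.
Let lmap_monoid : monoid_morphism lHom_map.
Proof.
split=> [|r r']; apply: left_homP => c.
  by rewrite -[LHS]/(lHom_map_fun _ _) /lHom_map_fun rmorph1 mul1r.
by rewrite lmap_mull -[LHS]/(lHom_map_fun _ _) /lHom_map_fun rmorphM mulrA.
Qed.
HB.instance Definition _ :=
  GRing.isNmodMorphism.Build R lHom lHom_map lmap_additive.
HB.instance Definition _ :=
  GRing.isMonoidMorphism.Build R lHom lHom_map lmap_monoid.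

Let lmap_central r (g : lHom) : lHom_map r * g = g * lHom_map r.
Proof. by apply: left_homP => c; rewrite lmap_mull lmap_mulr. Qed.

Definition lHom_alg : ralg R := @Ralg R lHom lHom_map lmap_central.

End Left.

Section Right.

Definition rHom : Type := right_hom C.
HB.instance Definition _ := GRing.Zmodule.copy rHom (right_hom C).

Definition rHom_mul (f g : rHom) : rHom := right_mul f g.
Definition rHom_one : rHom := bimod_right counit.

Let shift_left1 c : shift_left rHom_one c = c.
Proof. exact: counitl. Qed.

Let rmulA : associative rHom_mul.
Proof.
move=> f g h; apply: right_homP => c.
by rewrite !right_mulE shift_left_mul.
Qed.
Let rmul1r : right_id rHom_one rHom_mul.
Proof. by move=> f; apply: right_homP => c; rewrite right_mulE shift_left1. Qed.
Let rmul1l : left_id rHom_one rHom_mul.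
Proof.
move=> g; apply: right_homP => c; rewrite right_mulE.
rewrite -[in RHS](counitr c) /shift_left.
elim/cotens_ind: (comul c) => [a b|x y ex ey].
  rewrite contract_rightE contract_leftE right_homZ.
  rewrite -[LHS]/((bimod_left counit : left_hom C) _) left_homZ.
  by rewrite mulrC.
by rewrite crD clD !right_homD ex ey.
Qed.
Let rmulDl : left_distributive rHom_mul +%R.
Proof. by move=> f f' g; apply: right_homP => c. Qed.
Let rmulDr : right_distributive rHom_mul +%R.
Proof.
move=> f g g'; apply: right_homP => c.
by rewrite right_homDE !right_mulE shift_left_add right_homD.
Qed.

HB.instance Definition _ := GRing.Zmodule_isPzRing.Build rHom
  rmulA rmul1l rmul1r rmulDl rmulDr.

Definition rHom_map_fun (r : R) (c : C) : S := phi r * right_fun rHom_one c.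
Let rmapD r c d : rHom_map_fun r (c + d) = rHom_map_fun r c + rHom_map_fun r d.
Proof. by rewrite /rHom_map_fun right_homD mulrDr. Qed.
Let rmapZ r s c : rHom_map_fun r (inr2 s *: c) = s * rHom_map_fun r c.
Proof. by rewrite /rHom_map_fun right_homZ mulrCA. Qed.
Definition rHom_map (r : R) : rHom := mk_right (rmapD r) (rmapZ r).

Let rmap_mull r (g : rHom) c : right_fun (rHom_map r * g) c = phi r * right_fun g c.
Proof. by rewrite -[in RHS](mul1r g). Qed.
Let rmap_mulr r (g : rHom) c : right_fun (g * rHom_map r) c = phi r * right_fun g c.
Proof.
rewrite [LHS]right_mulE.
suff -> : shift_left (rHom_map r) c = inr2 (phi r) *: c by rewrite right_homZ.
rewrite -[in RHS](shift_left1 c) -contract_leftZ -inE /shift_left.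
elim/cotens_ind: (comul c) => [a b|x y ex ey].
  rewrite inE scaler_copure !contract_leftE -inE scalerA.
  by rewrite -rmorphM mulrC.
by rewrite scalerDr !clD ex ey.
Qed.

Let rmap_additive : nmod_morphism rHom_map.
Proof.
split=> [|r r']; apply: right_homP => c.
  by rewrite /right_fun /= /mk_right_fun /rHom_map_fun rmorph0 mul0r.
by rewrite right_homDE -[LHS]/(rHom_map_fun _ _) /rHom_map_fun rmorphD mulrDl.
Qed.
Let rmap_monoid : monoid_morphism rHom_map.
Proof.
split=> [|r r']; apply: right_homP => c.
  by rewrite -[LHS]/(rHom_map_fun _ _) /rHom_map_fun rmorph1 mul1r.
by rewrite rmap_mull -[LHS]/(rHom_map_fun _ _) /rHom_map_fun rmorphM mulrA.
Qed.
HB.instance Definition _ :=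
  GRing.isNmodMorphism.Build R rHom rHom_map rmap_additive.
HB.instance Definition _ :=
  GRing.isMonoidMorphism.Build R rHom rHom_map rmap_monoid.

Let rmap_central r (g : rHom) : rHom_map r * g = g * rHom_map r.
Proof. by apply: right_homP => c; rewrite rmap_mull rmap_mulr. Qed.

Definition rHom_alg : ralg R := @Ralg R rHom rHom_map rmap_central.

End Right.
End DualAlgebras.

(* Main.v *)
Require Import Defs.
From HB Require Import structures.
From mathcomp Require Import all_boot all_algebra.
From mathcomp Require Import boolp.

(* Write C(x,z) for C, the letters naming the tensor slots.  Bijectivity of
   tdelta says that C(x,z) (x)_R S(y) -> C(x,y) (x)_S C(y,z),
   c (x) y |-> c_(1) y (x) c_(2), is bijective.  Identifying slots in this
   isomorphism shows that C is invertible over S (x) S: with x = y = z, the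
   module C (x)_(S (x) S) S is isomorphic to S through eps, and with x = z its
   extension to S (x) S becomes C(x,y) (x) C(y,x).  Hence End_(S (x) S)(C) =
   S (x) S, and
     End_S(C) = Hom_(S(x) (x) S(y))(C(x,y) (x)_S C(y,z), C(x,y))
              = Hom_(S(y))(C(y,z), S(x) (x) S(y))
              = Hom_(S(y))(C(y,z), S(y)) (x) S(x),
   the inverse of g (x) s |-> (c |-> s c_(1) g(c_(2))).  This map reverses
   products, so the left-handed algebra tensored with S is the endomorphism ring
   of the S-dual of C; the right-handed version preserves products, and C itself
   is the splitting module.  One takes T = S in the definition of an Azumaya
   algebra, faithful flatness of S over R coming from Cayley-Hamilton. *)

Set Implicit Arguments.
Unset Strict Implicit.
Unset Printing Implicit Defensive.

Import GRing.Theory.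
Local Open Scope ring_scope.

(** * Dual bases and trace ideals *)

Definition lin_of (R : pzRingType) (U V : lmodType R) (f : U -> V)
    (fP : linear f) : {linear U -> V} :=
  HB.pack f (GRing.isLinear.Build R U V *:%R f fP).

(** The structure asks for compatibility with subtraction, which follows from additivity by
    cancelling [f y]. *)
Definition add_of (U V : zmodType) (f : U -> V)
    (fP : {morph f : x y / x + y}) : {additive U -> V} :=
  HB.pack f (GRing.isZmodMorphism.Build U V f
    (fun x y => addIr (f y) (etrans (esym (fP (x - y) y))
       (etrans (congr1 f (subrK y x)) (esym (subrK (f y) (f x))))))).

Section DualBasis.
Variable R : comPzRingType.
Implicit Types M N : lmodType R.

Definition dual_basis M n (e : 'I_n -> M) (e' : 'I_n -> {linear M -> R^o}) :=
  forall m, m = \sum_i (e' i m : R) *: e i.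

Lemma projective_dual_basis M n (e : 'I_n -> M) e' :
  dual_basis e e' -> projective M.
Proof.
move=> eP N N' p f p_surj.
have /choice[x xP] : forall i, exists x, p x = f (e i) by move=> i; exact: p_surj.
have gP : linear (fun m => \sum_i e' i m *: x i).
  move=> a u v; rewrite scaler_sumr -big_split; apply: eq_bigr => i _.
  by rewrite linearP scalerDl scalerA.
exists (lin_of gP) => m; rewrite [in RHS](eP m) !linear_sum.
by apply: eq_bigr => i _; rewrite !linearZ /= xP.
Qed.

Lemma fg_dual_basis M n (e : 'I_n -> M) e' :
  dual_basis e e' -> fin_generated M.
Proof. by move=> eP; exists n, e => m; exists (e'^~ m); exact: eP. Qed.

(** Projectivity splits the surjection from row vectors given by the generators; the components of
    the section are the forms [e']. *)
Lemma dual_basis_exists M : fin_generated M -> projective M ->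
  exists n (e : 'I_n -> M) e', dual_basis e e'.
Proof.
move=> [n [e eP]] projM.
have pP : linear (fun x : 'rV[R]_n => \sum_i x 0 i *: e i).
  move=> a u v; rewrite scaler_sumr -big_split; apply: eq_bigr => i _.
  by rewrite !mxE scalerDl scalerA.
have [m|g gP] := projM _ _ (lin_of pP) (idfun : {linear M -> M}).
  have [c ->] := eP m; exists (\row_i c i).
  by apply: eq_bigr => i _; rewrite mxE.
have e'P i : linear (fun m => g m 0 i : R^o).
  by move=> a u v; rewrite linearP !mxE.
exists n, e, (fun i => lin_of (e'P i)) => m; exact/esym/gP.
Qed.

Definition in_trace M (r : R) :=
  exists l : seq (M * {linear M -> R^o}), r = \sum_(p <- l) p.2 p.1.

Lemma in_trace_eval M (f : {linear M -> R^o}) m : in_trace M (f m).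
Proof. by exists [:: (m, f)]; rewrite big_seq1. Qed.

Lemma in_trace0 M : in_trace M 0.
Proof. by exists [::]; rewrite big_nil. Qed.

Lemma in_traceD M r s : in_trace M r -> in_trace M s -> in_trace M (r + s).
Proof. by move=> [l ->] [k ->]; exists (l ++ k); rewrite big_cat. Qed.

Lemma in_traceZ M a r : in_trace M r -> in_trace M (a * r).
Proof.
move=> [l ->]; exists [seq (a *: p.1, p.2) | p <- l].
by rewrite big_map mulr_sumr; apply: eq_bigr => p _; rewrite linearZ.
Qed.

(* Cayley-Hamilton: X := (e'_i(e_k)) fixes the generators e, so det (1 - X)
   kills M; modulo the trace ideal this determinant is 1. *)
Lemma in_trace1 M : faithfully_projective M -> in_trace M 1.
Proof.
move=> [fgM prM faM]; have [n [e [e' eP]]] := dual_basis_exists fgM prM.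
pose X : 'M[R]_n := \matrix_(k, i) e' i (e k).
pose Y := 1%:M - X.
have Ye k : \sum_i Y k i *: e i = 0.
  under eq_bigr => i _ do rewrite !mxE scalerBl.
  rewrite sumrB -eP (bigD1 k) //= eqxx scale1r big1 ?addr0 ?subrr // => i.
  by rewrite eq_sym => /negPf ->; rewrite scale0r.
have detYe k : \det Y *: e k = 0.
  transitivity (\sum_i (\adj Y *m Y) k i *: e i).
    rewrite mul_adj_mx (bigD1 k) //= !mxE eqxx big1 ?addr0 // => i.
    by rewrite !mxE eq_sym => /negPf ->; rewrite scale0r.
  under eq_bigr => i _ do rewrite mxE scaler_suml.
  rewrite exchange_big /= big1 // => j _.
  under eq_bigr => i _ do rewrite -scalerA.
  by rewrite -scaler_sumr Ye scaler0.
have det0 : \det Y = 0.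
  apply: faM => m; rewrite (eP m) scaler_sumr big1 // => i _.
  by rewrite scalerA mulrC -scalerA detYe scaler0.
(* The Leibniz expansions are compared term by term, then factor by factor: congruence modulo the
   trace ideal is stable under sums and products, and the entries of 1 and Y differ by values of the
   forms. *)
suff : in_trace M (\det (1%:M : 'M[R]_n) - \det Y) by rewrite det0 det1 subr0.
apply: (big_ind2 (fun a b => in_trace M (a - b))).
- by rewrite subrr; exact: in_trace0.
- by move=> a b c d ha hb; rewrite opprD addrACA; exact: in_traceD.
move=> s _; rewrite -mulrBr; apply: in_traceZ.
apply: (big_ind2 (fun a b => in_trace M (a - b))).
- by rewrite subrr; exact: in_trace0.
- move=> a b c d ha hb.
  have -> : a * c - b * d = c * (a - b) + b * (c - d).
    by rewrite !mulrBr addrA (mulrC c b) subrK (mulrC c a).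
  by apply: in_traceD; exact: in_traceZ.
by move=> i _; rewrite !mxE opprB addrC subrK; exact: in_trace_eval.
Qed.

Section Contract.
Variables (N M : lmodType R) (f : {linear M -> R^o}).

Let h n m : N := (f m : R) *: n.
Let h_balanced : balanced h.
Proof.
split=> [n n' m|n m m'|r n m]; rewrite /h.
- by rewrite scalerDr.
- by rewrite linearD scalerDl.
- by rewrite [f (_ *: _)]linearZ scalerA mulrC.
Qed.
Definition tens_contract : tens N M -> N := tens_lift h_balanced.
HB.instance Definition _ := GRing.Additive.on tens_contract.
Lemma tens_contractE n m : tens_contract (pure n m) = (f m : R) *: n.
Proof. exact: tens_liftE. Qed.

End Contract.

Lemma tens_contract_map (N N' M : lmodType R) (f : {linear M -> R^o})
    (g : {linear N -> N'}) x :
  tens_contract f (tmap g (idfun : {linear M -> M}) x) = g (tens_contract f x).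
Proof.
elim/tens_ind: x => [n m|x y ex ey]; last by rewrite !raddfD /= ex ey.
by rewrite tmapE !tens_contractE linearZ.
Qed.

(** Expanding the second factor and moving its coefficients to the left gives every tensor finitely
    many coordinates in N. *)
Lemma tens_dual_basis (N M : lmodType R) n (e : 'I_n -> M) e' (x : tens N M) :
  dual_basis e e' -> x = \sum_i pure (tens_contract (e' i) x) (e i).
Proof.
move=> eP; elim/tens_ind: x => [y m|x y ex ey].
  rewrite {1}(eP m); under [RHS]eq_bigr => i _ do rewrite tens_contractE pureZ.
  exact: (raddf_sum (add_of (pureDr y))).
rewrite {1}ex {1}ey -big_split; apply: eq_bigr => i _.
by rewrite raddfD pureDl.
Qed.

(** Exactness passes to the tensor product coordinate by coordinate along a dual basis. For the
    converse, 1 is a sum of values f(m), so y is the sum of the contractions by f of the tensors y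
    (x) m. *)
Lemma faithfully_projective_flat M :
  faithfully_projective M -> faithfully_flat M.
Proof.
move=> fpM; have [l lP] := in_trace1 fpM; case: fpM => fgM prM _.
have [k [e [e' eP]]] := dual_basis_exists fgM prM.
move=> N N' N'' f g; split=> ex y; split.
- move=> gy0; rewrite (tens_dual_basis y eP).
  have /choice[x xP] : forall i, exists x, f x = tens_contract (e' i) y.
    by move=> i; apply/ex; rewrite -tens_contract_map gy0 raddf0.
  exists (\sum_i pure (x i) (e i)); rewrite raddf_sum.
  by apply: eq_bigr => i _; rewrite /= tmapE xP.
- move=> [x <-]; elim/tens_ind: x => [n m|x x' ex1 ex2]; last first.
    by rewrite !raddfD /= ex1 ex2 addr0.
  rewrite !tmapE (_ : g (f n) = 0); last by apply/ex; exists n.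
  exact: (balanced0l (@balanced_pure _ _ _)).
- move=> gy0.
  have /choice[x xP] : forall p : M * {linear M -> R^o}, exists x,
      tmap f (idfun : {linear M -> M}) x = pure y p.1.
    move=> p; apply/ex; rewrite tmapE gy0.
    exact: (balanced0l (@balanced_pure _ _ _)).
  exists (\sum_(p <- l) tens_contract p.2 (x p)); rewrite linear_sum.
  rewrite -[RHS]scale1r lP scaler_suml; apply: eq_bigr => p _.
  by rewrite -tens_contract_map xP tens_contractE.
move=> [x <-]; rewrite -[LHS]scale1r lP scaler_suml big1 // => p _.
rewrite -tens_contractE -!(tmapE _ (idfun : {linear M -> M})).
rewrite (_ : tmap g _ _ = 0) ?raddf0 //; apply/ex.
by exists (pure x p.1).
Qed.

Lemma faithfully_projective_regular : faithfully_projective (R^o : lmodType R).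
Proof.
have idP : dual_basis (fun _ : 'I_1 => 1 : R^o)
    (fun _ => (idfun : {linear R^o -> R^o})).
  by move=> m; rewrite big_ord1; exact/esym/mulr1.
split; [exact: fg_dual_basis idP | exact: projective_dual_basis idP |].
by move=> r /(_ 1) r0; rewrite -[r]mulr1.
Qed.

End DualBasis.

(** * The comultiplication as a Galois isomorphism *)

Section TripleTensor.
Variables (R S : comPzRingType) (phi : {rmorphism R -> S}).

Lemma phi2E r : inl2 phi (phi r) = inr2 phi (phi r).
Proof. exact: (@cin_base R S S phi phi r). Qed.

Lemma in123E x y z :
  in1 phi x * in2 phi y * in3 phi z =
  cpure (phi2 phi) phi (cpure phi phi x y) z.
Proof.
rewrite -[in1 phi x * _](rmorphM (cinl (phi2 phi) phi)).
by rewrite [LHS]cpureM mulr1 mul1r [X in cpure _ _ X]cpureM mulr1 mul1r.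
Qed.

Lemma S3_ind (P : S3 phi -> Prop) :
  (forall x y z, P (in1 phi x * in2 phi y * in3 phi z)) ->
  (forall a b, P a -> P b -> P (a + b)) -> forall a, P a.
Proof.
move=> Pp PD; apply: ctens_ind => [p z|]; last exact: PD.
elim/ctens_ind: p => [x y|p q Pp1 Pq]; first by rewrite -in123E.
by rewrite [cpure _ _ _ _]apureDl; exact: PD.
Qed.

Lemma S2_lift (G : zmodType) (K : S -> S -> G) :
  (forall x x' y, K (x + x') y = K x y + K x' y) ->
  (forall x y y', K x (y + y') = K x y + K x y') ->
  (forall r x y, K (phi r * x) y = K x (phi r * y)) ->
  exists L : {additive S2 phi -> G},
    forall x y, L (inl2 phi x * inr2 phi y) = K x y.
Proof.
move=> K1 K2 KZ; pose L := @atens_lift R (calg phi) (calg phi) G K K1 K2 KZ.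
exists (L : {additive S2 phi -> G}) => x y.
by rewrite [inl2 _ _ * _]cpureM mulr1 mul1r [LHS]atens_liftE.
Qed.

(** Slots 1 and 2 are extended first with z fixed, then slot 3, because S3 is (S (x) S) (x) S. *)
Lemma S3_lift (G : zmodType) (K : S -> S -> S -> G) :
  (forall x x' y z, K (x + x') y z = K x y z + K x' y z) ->
  (forall x y y' z, K x (y + y') z = K x y z + K x y' z) ->
  (forall x y z z', K x y (z + z') = K x y z + K x y z') ->
  (forall r x y z, K (phi r * x) y z = K x (phi r * y) z) ->
  (forall r x y z, K x (phi r * y) z = K x y (phi r * z)) ->
  exists L : {additive S3 phi -> G},
    forall x y z, L (in1 phi x * in2 phi y * in3 phi z) = K x y z.
Proof.
move=> K1 K2 K3 K12 K23.
have /choice[k kP] : forall z, exists L : {additive S2 phi -> G},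
    forall x y, L (inl2 phi x * inr2 phi y) = K x y z.
  by move=> z; exact: S2_lift.
have h1 (p q : calg (phi2 phi)) (z : calg phi) : k z (p + q) = k z p + k z q.
  exact: raddfD.
have h2 (p : calg (phi2 phi)) (z z' : calg phi) :
    k (z + z') p = k z p + k z' p.
  elim/S2_ind: p => [x y|p q ep eq]; first by rewrite !kP K3.
  by rewrite !raddfD ep eq addrACA.
(* R acts on S (x) S through slot 1, so a scalar reaches slot 3 by way of slot 2. *)
have h3 r (p : calg (phi2 phi)) (z : calg phi) :
    k z (ralg_map (calg (phi2 phi)) r * p) = k (ralg_map (calg phi) r * z) p.
  elim/S2_ind: p => [x y|p q ep eq]; last by rewrite mulrDr !raddfD ep eq.
  by rewrite kP mulrA -[_ * inl2 _ _](rmorphM (inl2 phi)) kP K12 K23.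
pose L := @atens_lift R (calg (phi2 phi)) (calg phi) G _ h1 h2 h3.
exists (L : {additive S3 phi -> G}) => x y z.
rewrite in123E [LHS]atens_liftE -kP.
by rewrite [inl2 _ _ * _]cpureM mulr1 mul1r.
Qed.

End TripleTensor.

Section GaloisCoring.
Variables (R S : comPzRingType) (phi : {rmorphism R -> S}) (C : coring phi).
Local Notation in1 := (in1 phi).
Local Notation in2 := (in2 phi).
Local Notation in3 := (in3 phi).
Local Notation inl2 := (inl2 phi).
Local Notation inr2 := (inr2 phi).
Local Notation CC := (cotens C C).

(* The middle action on C (x)_S C: [mid y (c (x) d) = c y (x) d]. *)
Definition mid (y : S) (w : CC) : CC :=
  y *: (w : tens (restr inr2 C) (restr inl2 C)).

Lemma mid_copure y c d : mid y (copure c d) = copure (inr2 y *: c) d.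
Proof. exact: (@scale_pure S (restr inr2 C) (restr inl2 C)). Qed.
Lemma midD y w w' : mid y (w + w') = mid y w + mid y w'.
Proof. exact: (@scalerDr S (tens (restr inr2 C) (restr inl2 C))). Qed.
Lemma midDl y y' w : mid (y + y') w = mid y w + mid y' w.
Proof. exact: (@scalerDl S (tens (restr inr2 C) (restr inl2 C))). Qed.
Lemma midA y y' w : mid y (mid y' w) = mid (y * y') w.
Proof. exact: (@scalerA S (tens (restr inr2 C) (restr inl2 C))). Qed.
Lemma mid1 w : mid 1 w = w.
Proof. exact: (@scale1r S (tens (restr inr2 C) (restr inl2 C))). Qed.
Lemma midZ x y w : mid y (x *: w) = x *: mid y w.
Proof.
elim/S2_ind: x => [s t|p q ep eq]; last by rewrite !scalerDl midD ep eq.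
elim/cotens_ind: w => [c d|p q ep eq]; last by rewrite scalerDr !midD ep eq scalerDr.
rewrite mid_copure !scale_copure mid_copure.
by congr (copure _ _); rewrite !scalerA mulrC.
Qed.

Lemma mid_base r w : mid (phi r) w = inl2 (phi r) *: w.
Proof.
elim/cotens_ind: w => [c d|p q ep eq]; last by rewrite midD ep eq scalerDr.
by rewrite mid_copure scalel_copure phi2E.
Qed.

(** The three slots of S3 act on the left of C (x)_S C, between its factors, and on its right; this
    is the action that corresponds to C_3 (x) C_1. *)
Let act_ex : forall w : CC, exists L : {additive S3 phi -> CC},
  forall x y z, L (in1 x * in2 y * in3 z) = (inl2 x * inr2 z) *: mid y w.
Proof.
move=> w; apply: S3_lift.
- by move=> x x' y z; rewrite rmorphD mulrDl scalerDl.
- by move=> x y y' z; rewrite midDl scalerDr.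
- by move=> x y z z'; rewrite rmorphD mulrDr scalerDl.
- move=> r x y z.
  by rewrite -midA mid_base !scalerA rmorphM -!mulrA (mulrC (inl2 (phi r))) mulrA.
- move=> r x y z.
  by rewrite -midA mid_base phi2E !scalerA rmorphM -!mulrA (mulrC (inr2 z)).
Qed.

Let act w a : CC := projT1 (cid (act_ex w)) a.
Let actE w x y z :
  act w (in1 x * in2 y * in3 z) = (inl2 x * inr2 z) *: mid y w.
Proof. exact: (projT2 (cid (act_ex w))). Qed.
Let actDr w a b : act w (a + b) = act w a + act w b.
Proof. exact: raddfD. Qed.
Let actDl w w' a : act (w + w') a = act w a + act w' a.
Proof.
elim/S3_ind: a => [x y z|a b ea eb]; first by rewrite !actE midD scalerDr.
by rewrite !actDr ea eb addrACA.
Qed.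
Let actA w a b : act (act w b) a = act w (a * b).
Proof.
elim/S3_ind: a => [x y z|a a' ea ea']; last by rewrite actDr ea ea' mulrDl actDr.
elim/S3_ind: b => [x' y' z'|b b' eb eb']; last first.
  by rewrite actDr actDl eb eb' mulrDr actDr.
rewrite mulrACA [in1 x * _ * (in1 _ * _)]mulrACA -!rmorphM !actE midZ midA scalerA.
by rewrite mulrACA !rmorphM.
Qed.
Let act_copurel c d s t :
  act (copure c d) (in1 s * in2 t) = copure ((inl2 s * inr2 t) *: c) d.
Proof.
rewrite -[_ * _]mulr1 -(rmorph1 in3) actE mid_copure rmorph1 mulr1.
by rewrite scalel_copure scalerA.
Qed.
Let act_copurer c d s t :
  act (copure c d) (in2 s * in3 t) = copure c ((inl2 s * inr2 t) *: d).
Proof.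
rewrite -[in2 s]mul1r -(rmorph1 in1) actE mid_copure rmorph1 mul1r.
by rewrite scaler_copure copureZ scalerA mulrC.
Qed.
Let act_eta3 c d p : act (copure c d) (eta3 phi p) = copure (p *: c) d.
Proof.
elim/S2_ind: p => [s t|p q ep eq]; first by rewrite rmorphM eta3l eta3r act_copurel.
by rewrite rmorphD actDr ep eq scalerDl copureDl.
Qed.
Let act_eta1 c d p : act (copure c d) (eta1 phi p) = copure c (p *: d).
Proof.
elim/S2_ind: p => [s t|p q ep eq]; first by rewrite rmorphM eta1l eta1r act_copurer.
by rewrite rmorphD actDr ep eq scalerDl copureDr.
Qed.

(** [L] sends (c (x) a) (x) (d (x) b) to ab acting on c (x) d, so it undoes [kappa] and turns
    scalars of S3 into the slot action. It is built one variable at a time, first over C_1, then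
    over C_3. *)
Let kinv : exists L : {additive tens (C3 C) (C1 C) -> CC},
  (forall z, L (kappa z) = z) /\ (forall a z, L (a *: kappa z) = act z a).
Proof.
have ex2 c a : exists L : {additive C1 C -> CC},
    forall d b, L (bpure (eta1 phi) d b) = act (copure c d) (a * b).
  pose h d b := act (copure c d) (a * b).
  have h1 d d' b : h (d + d') b = h d b + h d' b by rewrite /h copureDr actDl.
  have h2 d b b' : h d (b + b') = h d b + h d b' by rewrite /h mulrDr actDr.
  have h3 p d b : h (p *: d) b = h d (eta1 phi p * b).
    by rewrite /h -act_eta1 actA -mulrA (mulrC b).
  exists (bc_lift h1 h2 h3 : {additive C1 C -> CC}) => d b; exact: bc_liftE.
pose k c a v := projT1 (cid (ex2 c a)) v.
have kE c a d b : k c a (bpure (eta1 phi) d b) = act (copure c d) (a * b).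
  exact: (projT2 (cid (ex2 c a))).
have kD c a v v' : k c a (v + v') = k c a v + k c a v' by exact: raddfD.
have k1 c c' a v : k (c + c') a v = k c a v + k c' a v.
  elim/bc_ind: v => [d b|v v' e e']; last by rewrite !kD e e' addrACA.
  by rewrite !kE copureDl actDl.
have k2 c a a' v : k c (a + a') v = k c a v + k c a' v.
  elim/bc_ind: v => [d b|v v' e e']; last by rewrite !kD e e' addrACA.
  by rewrite !kE mulrDl actDr.
have k3 p c a v : k (p *: c) a v = k c (eta3 phi p * a) v.
  elim/bc_ind: v => [d b|v v' e e']; last by rewrite !kD e e'.
  by rewrite !kE -act_eta3 actA mulrC -mulrA mulrCA mulrA.
have ex1 (v : C1 C) : exists L : {additive C3 C -> CC}, forall c a,
    L (bpure (eta3 phi) c a) = k c a v.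
  exists (bc_lift (fun c c' a => k1 c c' a v) (fun c a a' => k2 c a a' v)
    (fun p c a => k3 p c a v) : {additive C3 C -> CC}) => c a; exact: bc_liftE.
pose h u v := projT1 (cid (ex1 v)) u.
have hE c a d b :
    h (bpure (eta3 phi) c a) (bpure (eta1 phi) d b) = act (copure c d) (a * b).
  by rewrite /h (projT2 (cid (ex1 _))) kE.
have hDl u u' v : h (u + u') v = h u v + h u' v by exact: raddfD.
have hDr u v v' : h u (v + v') = h u v + h u v'.
  elim/bc_ind: u => [c a|u u' e e']; last by rewrite !hDl e e' addrACA.
  by rewrite /h !(projT2 (cid (ex1 _))) kD.
have hZ a u v : h (a *: u) v = h u (a *: v).
  elim/bc_ind: u => [c b|u u' e e']; last by rewrite scalerDr !hDl e e'.
  elim/bc_ind: v => [d b'|v v' e e']; last by rewrite scalerDr !hDr e e'.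
  by rewrite !scale_bpure !hE mulrCA mulrA.
have hb : balanced h := And3 hDl hDr hZ.
have [L LP] : exists L : {additive tens (C3 C) (C1 C) -> CC},
    forall u v, L (pure u v) = h u v.
  by exists (tens_lift hb) => u v; exact: tens_liftE.
exists L.
have LE a z : L (a *: kappa z) = act z a.
  elim/cotens_ind: z => [c d|z z' e e']; last first.
    by rewrite raddfD scalerDr raddfD e e' actDl.
  by rewrite kappaE scale_pure scale_bpure LP hE !mulr1.
split=> // z; rewrite -[kappa z]scale1r [LHS]LE.
have -> : 1 = in1 1 * in2 1 * in3 1 by rewrite !rmorph1 !mulr1.
by rewrite actE !rmorph1 mulr1 scale1r mid1.
Qed.

Lemma kappa_mid y z : kappa (mid y z) = in2 y *: kappa z.
Proof.
elim/cotens_ind: z => [c d|z z' e e']; last first.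
  by rewrite midD !(raddfD (@kappa _ _ _ C)) /= e e' scalerDr.
by rewrite mid_copure !kappaE bpureZ eta3r scale_pure scale_bpure.
Qed.

Hypothesis tdelta_bij : bijective (tdelta (C := C)).

(* Bijectivity of tdelta means that c (x) y |-> mid y (Delta c) is an
   isomorphism from C (x)_R S to C (x)_S C; the next two lemmas express its
   surjectivity and the universal property of its source. *)
Lemma mid_comul_ind (P : CC -> Prop) :
  (forall y c, P (mid y (comul C c))) ->
  (forall z z', P z -> P z' -> P (z + z')) -> forall z, P z.
Proof.
move=> Pm PD z; have [L [LK LE]] := kinv; have [g gK Kg] := tdelta_bij.
(* As [tdelta] is onto, z is the image under [L] of [tdelta] of a sum of generators c (x) a of C_2.
   Slots 1 and 3 of a are absorbed into c because Delta is bilinear, which leaves the middle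
   scalar. *)
rewrite -[z]LK -[kappa z]Kg.
elim/bc_ind: (g _) => [c a|w w' Pw Pw']; last by rewrite !raddfD; exact: PD.
rewrite tdeltaE LE; elim/S3_ind: a => [s y t|a b Pa Pb].
  by rewrite actE -midZ -linearZ; exact: Pm.
by rewrite actDr; exact: PD.
Qed.

Lemma mid_comul_lift (G : zmodType) (H : C -> S -> G) :
  (forall c c' y, H (c + c') y = H c y + H c' y) ->
  (forall c y y', H c (y + y') = H c y + H c y') ->
  (forall r c y, H (inl2 (phi r) *: c) y = H c (phi r * y)) ->
  exists L : {additive CC -> G}, forall y c, L (mid y (comul C c)) = H c y.
Proof.
move=> H1 H2 HZ; have [g gK Kg] := tdelta_bij.
(* H is extended to C_2: slots 1 and 3 act on c, slot 2 becomes the second argument of H. *)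
have /choice[h hP] : forall c, exists L : {additive S3 phi -> G},
    forall x y z, L (in1 x * in2 y * in3 z) = H ((inl2 x * inr2 z) *: c) y.
  move=> c; apply: S3_lift.
  - by move=> x x' y z; rewrite rmorphD mulrDl scalerDl H1.
  - by move=> x y y' z; rewrite H2.
  - by move=> x y z z'; rewrite rmorphD mulrDr scalerDl H1.
  - by move=> r x y z; rewrite -HZ scalerA rmorphM mulrA.
  - by move=> r x y z; rewrite -HZ scalerA phi2E rmorphM mulrCA.
have h1 c c' a : h (c + c') a = h c a + h c' a.
  elim/S3_ind: a => [x y z|a b ea eb]; first by rewrite !hP scalerDr H1.
  by rewrite !raddfD ea eb addrACA.
have h2 c a a' : h c (a + a') = h c a + h c a' by exact: raddfD.
have h3 p c a : h (p *: c) a = h c (eta2 phi p * a).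
  elim/S3_ind: a => [x y z|a b ea eb]; last by rewrite mulrDr !raddfD ea eb.
  elim/S2_ind: p => [s t|p q ep eq]; last first.
    by rewrite scalerDl h1 rmorphD mulrDl raddfD ep eq.
  rewrite rmorphM eta2l eta2r -(mulr1 (in1 s)) -(rmorph1 in2).
  rewrite mulrACA [in1 s * _ * (in1 _ * _)]mulrACA -!rmorphM mul1r !hP scalerA.
  by rewrite mulrACA -!rmorphM (mulrC x) (mulrC z).
have gD : {morph g : u v / u + v}.
  by move=> u v; apply: (can_inj gK); rewrite raddfD /= !Kg.
(* By [kappa_mid], the element mid y (Delta c) corresponds to [tdelta] of c (x) [in2 y]. *)
exists (bc_lift h1 h2 h3 \o add_of gD \o kappa (C := C) : {additive _ -> _}) => y c /=.
rewrite kappa_mid -tdeltaE gK bc_liftE.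
have -> : in2 y = in1 1 * in2 y * in3 1 by rewrite !rmorph1 mulr1 mul1r.
by rewrite hP !rmorph1 mulr1 scale1r.
Qed.

End GaloisCoring.

(** * Invertibility over S (x) S *)

Section RankOne.
Variables (R S : comPzRingType) (phi : {rmorphism R -> S}) (C : coring phi).
Local Notation inl2 := (inl2 phi).
Local Notation inr2 := (inr2 phi).
Local Notation mul2 := (mul2 phi).
Local Notation S2 := (S2 phi).
Local Notation CC := (cotens C C).

Definition counitS (c : C) : S := counit C c.

Lemma counitSD c d : counitS (c + d) = counitS c + counitS d.
Proof. exact: raddfD. Qed.
Lemma counitSZ p c : counitS (p *: c) = mul2 p * counitS c.
Proof. exact: (linearZ_LR (counit C)). Qed.

Definition twist : {rmorphism S2 -> S2} :=
  @clift R S S phi phi S2 inr2 inl2 (fun r => esym (phi2E phi r)).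

Lemma twistE s t : twist (inl2 s * inr2 t) = inl2 t * inr2 s.
Proof.
by rewrite [inl2 s * _]cpureM mulr1 mul1r /twist [LHS]cliftE mulrC.
Qed.
Lemma twist_inl s : twist (inl2 s) = inr2 s.
Proof. by rewrite -[inl2 s]mulr1 -(rmorph1 inr2) twistE rmorph1 mul1r. Qed.
Lemma twist_inr s : twist (inr2 s) = inl2 s.
Proof. by rewrite -[inr2 s]mul1r -(rmorph1 inl2) twistE rmorph1 mulr1. Qed.
Lemma twistK : involutive twist.
Proof.
elim/S2_ind => [s t|p q ep eq]; first by rewrite !twistE.
by rewrite !raddfD /= ep eq.
Qed.

(* l(inl2 s d) = inr2 s l(d), resp. l(inr2 s c) = inl2 s l(c): exactly what
   makes c (x) d |-> l(d) c, resp. c (x) d |-> l(c) d, well defined. *)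
Definition lform := {linear restr inl2 C -> restr inr2 S2^o}.
Definition rform := {linear restr inr2 C -> restr inl2 S2^o}.

Section Forms.
Variables (l : lform) (m : rform).
Lemma lformD c d : l (c + d) = l c + l d :> S2.
Proof. exact: raddfD. Qed.
Lemma lformZ s c : l (inl2 s *: c) = inr2 s * (l c : S2) :> S2.
Proof. exact: (linearZ_LR l). Qed.
Lemma rformD c d : m (c + d) = m c + m d :> S2.
Proof. exact: raddfD. Qed.
Lemma rformZ s c : m (inr2 s *: c) = inl2 s * (m c : S2) :> S2.
Proof. exact: (linearZ_LR m). Qed.

Let h c d : C := (l d : S2) *: c.
Let hDl c c' d : h (c + c') d = h c d + h c' d.
Proof. exact: scalerDr. Qed.
Let hDr c d d' : h c (d + d') = h c d + h c d'.
Proof. by rewrite /h lformD scalerDl. Qed.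
Let hZ s c d : h (inr2 s *: c) d = h c (inl2 s *: d).
Proof. by rewrite /h lformZ scalerA mulrC. Qed.
Definition lcontract : CC -> C := colift hDl hDr hZ.
HB.instance Definition _ := GRing.Additive.on lcontract.
Lemma lcontractE c d : lcontract (copure c d) = (l d : S2) *: c.
Proof. exact: coliftE. Qed.
Lemma lcontract_mid y z : lcontract (mid y z) = inr2 y *: lcontract z.
Proof.
elim/cotens_ind: z => [c d|z z' e e']; last first.
  by rewrite midD !(raddfD lcontract) /= e e' scalerDr.
by rewrite mid_copure !lcontractE !scalerA mulrC.
Qed.

Let k c d : C := (m c : S2) *: d.
Let kDl c c' d : k (c + c') d = k c d + k c' d.
Proof. by rewrite /k rformD scalerDl. Qed.
Let kDr c d d' : k c (d + d') = k c d + k c d'.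
Proof. exact: scalerDr. Qed.
Let kZ s c d : k (inr2 s *: c) d = k c (inl2 s *: d).
Proof. by rewrite /k rformZ scalerA mulrC. Qed.
Definition rcontract : CC -> C := colift kDl kDr kZ.
HB.instance Definition _ := GRing.Additive.on rcontract.
Lemma rcontractE c d : rcontract (copure c d) = (m c : S2) *: d.
Proof. exact: coliftE. Qed.
Lemma rcontract_mid y z : rcontract (mid y z) = inl2 y *: rcontract z.
Proof.
elim/cotens_ind: z => [c d|z z' e e']; last first.
  by rewrite midD !(raddfD rcontract) /= e e' scalerDr.
by rewrite mid_copure !rcontractE rformZ scalerA.
Qed.
End Forms.

Hypothesis tdelta_bij : bijective (tdelta (C := C)).

(* Both sides are values at c (x) d of additive maps on C (x)_S C that send
   mid y (Delta c) to y psi(c). *)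
Lemma counit_swap (X : lmodType S) (psi : {linear C -> restr mul2 X}) c d :
  counitS c *: (psi d : X) = counitS d *: (psi c : X).
Proof.
have psiZ p a : psi (p *: a) = mul2 p *: (psi a : X) :> X.
  exact: (linearZ_LR psi).
have psiD a b : psi (a + b) = (psi a : X) + (psi b : X) :> X by exact: raddfD.
suff e z : psi (contract_left (bimod_right (counit C)) z) =
           psi (contract_right (bimod_left (counit C)) z) :> X.
  have := e (copure c d); rewrite contract_leftE contract_rightE !psiZ.
  by rewrite mul2l mul2r.
elim/(mid_comul_ind tdelta_bij): z => [y a|z z' e e']; last first.
  by rewrite !(raddfD (contract_left _)) !(raddfD (contract_right _)) !psiD e e'.
(* The middle scalar comes out on the left under one contraction and on the right under the other;
   psi identifies the two sides through [mul2]. *)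
have ml w : contract_left (bimod_right (counit C)) (mid y w) =
            inl2 y *: contract_left (bimod_right (counit C)) w.
  elim/cotens_ind: w => [b b'|z z' e e']; last first.
    by rewrite midD !(raddfD (contract_left _)) /= e e' scalerDr.
  by rewrite mid_copure !contract_leftE right_homZ rmorphM scalerA.
have mr w : contract_right (bimod_left (counit C)) (mid y w) =
            inr2 y *: contract_right (bimod_left (counit C)) w.
  elim/cotens_ind: w => [b b'|z z' e e']; last first.
    by rewrite midD !(raddfD (contract_right _)) /= e e' scalerDr.
  by rewrite mid_copure !contract_rightE !scalerA mulrC.
by rewrite ml mr counitl counitr !psiZ mul2l mul2r.
Qed.

Hypothesis fpC : faithfully_projective (coring_mod C).

(** Since c = eps(c_(1)) c_(2), any psi linear along [mul2] satisfies psi(c) = eps(psi(c_(2))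
    c_(1)), so its values lie in the image of eps. This is applied to [mul2] after the forms f whose
    values sum to 1. *)
Lemma counit_onto : exists u, counitS u = 1.
Proof.
have [l lP] := in_trace1 fpC.
have im (psi : C -> S) : (forall a b, psi (a + b) = psi a + psi b) ->
    (forall p a, psi (p *: a) = mul2 p * psi a) ->
    forall c, exists u, psi c = counitS u.
  move=> psiD psiZ c; rewrite -[c](counitl c).
  elim/cotens_ind: (comul C c) => [a b|z z' [u e] [u' e']].
    rewrite contract_leftE psiZ mul2l.
    exists (inl2 (psi b) *: a).
    by rewrite counitSZ mul2l mulrC.
  by exists (u + u'); rewrite raddfD psiD e e' counitSD.
rewrite -(rmorph1 mul2) lP rmorph_sum /=.
elim: l {lP} => [|[c f] l [u uP]]; first by exists 0; rewrite big_nil [LHS]raddf0.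
have [|p a|v vP] := im (fun c => mul2 (f c)) _ _ c.
- by move=> a b; rewrite !raddfD.
- by rewrite linearZ rmorphM.
by exists (v + u); rewrite big_cons counitSD uP vP.
Qed.

(** The swap exchanges the two actions as [lform] demands; the resulting form is moreover semilinear
    along [twist] for all of S (x) S. *)
Lemma lform_of_subproof (f : {linear C -> S2^o}) :
  linear (fun c : restr inl2 C => twist (f c) : restr inr2 S2^o).
Proof.
move=> s a b; rewrite [s *: a]restrE linearP rmorphD rmorphM.
by rewrite [s *: _]restrE twist_inl.
Qed.
Definition lform_of (f : {linear C -> S2^o}) : lform :=
  lin_of (lform_of_subproof f).

(** The scalar t acts on the right of c_(2), and [twist] brings it to the left slot, next to s. Thus
    contracting Delta c gives a map of c to which [counit_swap] applies. *)
Lemma lcontract_comulZ f p c :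
  lcontract (lform_of f) (comul C (p *: c)) =
  inl2 (mul2 p) *: lcontract (lform_of f) (comul C c).
Proof.
rewrite (linearZ_LR (comul C)); elim/S2_ind: p => [s t|p q ep eq]; last first.
  by rewrite scalerDl raddfD /= ep eq -scalerDl -!rmorphD.
rewrite rmorphM mul2l mul2r.
elim/cotens_ind: (comul C c) => [a b|z z' e e']; last first.
  by rewrite scalerDr !(raddfD (lcontract _)) /= e e' scalerDr.
have fZ r v : f (r *: v) = r * (f v : S2) :> S2 := linearZ_LR f r v.
rewrite scale_copure !lcontractE /= fZ rmorphM /= twist_inr !scalerA.
by rewrite rmorphM mulrAC (mulrC (inl2 t)).
Qed.

(* As eps(u) = 1, counit_swap makes every functional value lcontract z a
   multiple, by a scalar depending on z only, of its value at Delta u: the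
   S2-module C (x) C^op is generated by Delta u. *)
Lemma lcontract_span u : counitS u = 1 -> forall z, exists b : S2, forall f,
  lcontract (lform_of f) z = b *: lcontract (lform_of f) (comul C u).
Proof.
move=> u1; apply: (mid_comul_ind tdelta_bij) => [y c|z z' [b e] [b' e']].
  (* The scalar y comes out through the right slot, and [counit_swap] with eps(u) = 1 turns the
     value at Delta c into eps(c) times the value at Delta u. *)
  exists (inr2 y * inl2 (counitS c)) => f; rewrite lcontract_mid -scalerA.
  congr (_ *: _).
  have gP : linear (fun c : C => lcontract (lform_of f) (comul C c)
      : restr mul2 (restr inl2 C)).
    by move=> p a a'; rewrite linearD raddfD /= lcontract_comulZ.
  have := counit_swap (lin_of gP) c u; rewrite u1 scale1r; exact: esym.
by exists (b + b') => f; rewrite raddfD /= e e' scalerDl.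
Qed.

(** f commutes with contraction of the second factor, so on the contractions of Delta u it is
    multiplication by the scalar r found for (f (x) id)(Delta u). Every twist(g(v)) c is a multiple
    of such a contraction, and c is a sum of those because the g(v) sum to 1. *)
Lemma end_scalar (f : {linear C -> C}) : exists r : S2, forall c, f c = r *: c.
Proof.
have [u u1] := counit_onto; have [l lP] := in_trace1 fpC.
have [r rP] := lcontract_span u1 (cotmap f idfun (comul C u)).
have fG g z : f (lcontract (lform_of g) z) =
              lcontract (lform_of g) (cotmap f idfun z).
  elim/cotens_ind: z => [c d|z z' e e']; last by rewrite !raddfD /= e e'.
  by rewrite cotmapE !lcontractE linearZ.
exists r => c; rewrite -[f c]scale1r -[in RHS](scale1r c) -(rmorph1 twist) lP.
rewrite rmorph_sum !scaler_suml scaler_sumr; apply: eq_bigr => -[v g] _ /=.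
have [b bP] := lcontract_span u1 (copure c v).
have fZ p a : f (p *: a) = p *: f a := linearZ_LR f p a.
rewrite -fZ.
have -> : twist (g v) *: c = lcontract (lform_of g) (copure c v).
  by rewrite lcontractE.
by rewrite bP fZ fG rP !scalerA mulrC.
Qed.

End RankOne.

(** * The action of left linear maps *)

Lemma faithful_inj (R : comPzRingType) (M : lmodType R) (r r' : R) :
  faithful M -> (forall m : M, r *: m = r' *: m) -> r = r'.
Proof.
by move=> faM rr'; apply/subr0_eq/faM => m; rewrite scalerBl rr' subrr.
Qed.

Lemma lhom_sumE (R : pzRingType) (U V : lmodType R) (I : Type) (r : seq I)
    (f : I -> lhom U V) u : (\sum_(i <- r) f i) u = \sum_(i <- r) f i u.
Proof. by elim: r => [|i r IH]; rewrite ?big_nil // !big_cons lhomDE IH. Qed.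

(** * Coordinates of S (x) S over each of its factors *)

Section Coordinates.
Variables (R S : comPzRingType) (phi : {rmorphism R -> S}).
Local Notation inl2 := (inl2 phi).
Local Notation inr2 := (inr2 phi).
Local Notation S2 := (S2 phi).
Variables (n : nat) (e : 'I_n -> S) (e' : 'I_n -> S -> R).
Hypothesis eP : forall s, s = \sum_i phi (e' i s) * e i.
Hypothesis e'D : forall i s t, e' i (s + t) = e' i s + e' i t.
Hypothesis e'Z : forall i r s, e' i (phi r * s) = r * e' i s.

(** [q i] is e'_i (x) id: expanding the first slot shows that the e_i (x) 1 and the [q i] form a
    dual basis over the second one. *)
Lemma S2_coord : exists q : 'I_n -> {additive S2 -> S},
  [/\ forall i s t, q i (inl2 s * inr2 t) = phi (e' i s) * t,
      forall i s p, q i (inr2 s * p) = s * q i p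
    & forall p, p = \sum_i inl2 (e i) * inr2 (q i p)].
Proof.
have /choice[q qP] : forall i, exists L : {additive S2 -> S},
    forall s t, L (inl2 s * inr2 t) = phi (e' i s) * t.
  move=> i; apply: S2_lift => [s s' t|s t t'|r s t].
  - by rewrite e'D rmorphD mulrDl.
  - by rewrite mulrDr.
  - by rewrite e'Z rmorphM mulrAC mulrC mulrA.
exists q; split=> // [i s p|p].
  elim/S2_ind: p => [x y|p p' ep ep']; last by rewrite mulrDr !raddfD ep ep' mulrDr.
  by rewrite mulrCA -rmorphM !qP mulrCA.
elim/S2_ind: p => [x y|p p' ep ep'].
  rewrite {1}(eP x) rmorph_sum mulr_suml; apply: eq_bigr => i _.
  by rewrite qP !rmorphM /= phi2E mulrAC mulrC mulrA.
rewrite {1}ep {1}ep' -big_split; apply: eq_bigr => i _.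
by rewrite raddfD rmorphD mulrDr.
Qed.

Lemma S2_coord_twist : exists q : 'I_n -> {additive S2 -> S},
  [/\ forall i s t, q i (inr2 s * inl2 t) = phi (e' i s) * t,
      forall i s p, q i (inl2 s * p) = s * q i p
    & forall p, p = \sum_i inr2 (e i) * inl2 (q i p)].
Proof.
have [q [q1 q2 q3]] := S2_coord.
exists (fun i => q i \o twist phi : {additive S2 -> S}); split=> [i s t|i s p|p].
- rewrite -[LHS]/(q i (twist phi (inr2 s * inl2 t))).
  by rewrite rmorphM twist_inl twist_inr q1.
- rewrite -[LHS]/(q i (twist phi (inl2 s * p))).
  by rewrite rmorphM twist_inl q2.
rewrite -{1}(twistK p) {1}(q3 (twist phi p)) rmorph_sum.
by apply: eq_bigr => i _; rewrite rmorphM twist_inl twist_inr.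
Qed.

(** With its mirror for the other factor, this serves to keep C finitely generated projective when
    scalars are restricted from S (x) S to one copy of S. *)
Lemma dual_basis_inr2 : exists f' : 'I_n -> {linear restr inr2 S2^o -> S^o},
  dual_basis (fun i => inl2 (e i) : restr inr2 S2^o) f'.
Proof.
have [q [_ qZ qP]] := S2_coord.
have lq i : linear (q i : restr inr2 S2^o -> S^o).
  by move=> s x y; rewrite raddfD; congr (_ + _); exact: qZ.
by exists (fun i => lin_of (lq i)) => p; rewrite {1}(qP p);
   apply: eq_bigr => i _; exact: mulrC.
Qed.

Lemma dual_basis_inl2 : exists f' : 'I_n -> {linear restr inl2 S2^o -> S^o},
  dual_basis (fun i => inr2 (e i) : restr inl2 S2^o) f'.
Proof.
have [q [_ qZ qP]] := S2_coord_twist.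
have lq i : linear (q i : restr inl2 S2^o -> S^o).
  by move=> s x y; rewrite raddfD; congr (_ + _); exact: qZ.
by exists (fun i => lin_of (lq i)) => p; rewrite {1}(qP p);
   apply: eq_bigr => i _; exact: mulrC.
Qed.

End Coordinates.

Section DualActions.
Variables (R S : comPzRingType) (phi : {rmorphism R -> S}) (C : coring phi).
Local Notation inl2 := (inl2 phi).
Local Notation inr2 := (inr2 phi).
Local Notation mul2 := (mul2 phi).
Local Notation S2 := (S2 phi).
Local Notation CC := (cotens C C).
Local Notation comul := (comul C).
Local Notation lA := (lHom_alg C).

Section LeftAction.

Lemma shift_right_linear (g : lA) :
  linear (shift_right (g : left_hom C) : restr inl2 C -> restr inl2 C).
Proof.
by move=> s c d; rewrite [LHS]shift_rightD; congr (_ + _); exact: shift_rightZ.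
Qed.
Definition shift_right_end (g : lA) : End (restr inl2 C) :=
  lin_of (@shift_right_linear g).

Definition lact_pure (g : lA) (s : calg phi) : End (restr inl2 C) :=
  ralg_map (End (restr inl2 C)) s * shift_right_end g.

Lemma lact_pureE g s c : lact_pure g s c = inl2 s *: shift_right (g : left_hom C) c.
Proof. by []. Qed.

Lemma lHom_mapE r c : left_fun (lHom_map C r) c = phi r * left_fun (lHom_one C) c.
Proof. by []. Qed.

Lemma lHom_mulE (g f : lA) c :
  left_fun (g * f) c = left_fun f (shift_right (g : left_hom C) c).
Proof. by []. Qed.

Lemma lHom_map_mulE r (g : lA) c :
  left_fun (ralg_map lA r * g) c = phi r * left_fun g c.
Proof.
(* Centrality puts the scalar second in the product, where it simply multiplies the value. *)
rewrite ralg_central lHom_mulE lHom_mapE.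
by rewrite -[left_fun _ (shift_right _ _)]/(left_fun (g * 1) c) mulr1.
Qed.

Lemma shift_right1 c : shift_right (lHom_one C) c = c.
Proof. exact: counitr. Qed.

Let lact_pureDl g g' s : lact_pure (g + g') s = lact_pure g s + lact_pure g' s.
Proof.
apply: lhomP => c; rewrite lhomDE !lact_pureE -scalerDr.
by congr (_ *: _); exact: shift_right_add.
Qed.
Let lact_pureDr g s s' : lact_pure g (s + s') = lact_pure g s + lact_pure g s'.
Proof. by rewrite /lact_pure rmorphD mulrDl. Qed.
Let lact_pureZ r g s :
  lact_pure (ralg_map lA r * g) s = lact_pure g (ralg_map (calg phi) r * s).
Proof.
apply: lhomP => c; rewrite !lact_pureE rmorphM mulrC -scalerA; congr (_ *: _).
rewrite /shift_right -contract_rightZ.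
elim/cotens_ind: (comul c) => [a b|x y ex ey]; last first.
  by rewrite scalerDr !(raddfD (contract_right _)) /= ex ey.
rewrite scalel_copure !contract_rightE lHom_map_mulE.
by rewrite phi2E scalerA rmorphM mulrC.
Qed.

Definition lact : atens lA (calg phi) -> End (restr inl2 C) :=
  atens_lift lact_pureDl lact_pureDr lact_pureZ.
HB.instance Definition _ := GRing.Additive.on lact.

Lemma lactE g s c : lact (apure g s) c = inl2 s *: shift_right (g : left_hom C) c.
Proof. by rewrite /lact atens_liftE. Qed.

(* An anti-homomorphism, as shift_right (g * f) = shift_right f \o shift_right g. *)
Lemma lactM x y : lact (x * y) = lact y * lact x.
Proof.
elim/atens_ind: x => [g s|x x' e e']; last by rewrite mulrDl !(raddfD lact) /= mulrDr e e'.
elim/atens_ind: y => [f t|y y' e e']; last by rewrite mulrDr !(raddfD lact) /= mulrDl e e'.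
rewrite apureM; apply: lhomP => c.
rewrite -[RHS]/(lact _ (lact _ c)) !lactE shift_rightZ scalerA.
rewrite mulrC -rmorphM; congr (_ *: _).
exact/esym/(@shift_right_mul _ _ _ C f g c).
Qed.

Lemma lact_ainr s : lact (apure 1 s) = ralg_map (End (restr inl2 C)) s.
Proof. by apply: lhomP => c; rewrite lactE shift_right1. Qed.

End LeftAction.

Section Bijectivity.
Variables (n : nat) (e : 'I_n -> S) (e' : 'I_n -> S -> R).
Hypothesis eP : forall s, s = \sum_i phi (e' i s) * e i.
Hypothesis e'D : forall i s t, e' i (s + t) = e' i s + e' i t.
Hypothesis e'Z : forall i r s, e' i (phi r * s) = r * e' i s.
Hypothesis tdelta_bij : bijective (tdelta (C := C)).
Hypothesis fpC : faithfully_projective (coring_mod C).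

Let faithC (r r' : S2) : (forall c : C, r *: c = r' *: c) -> r = r'.
Proof. by case: fpC => _ _; exact: faithful_inj. Qed.

(** A sum of tensors g (x) s is encoded by the form l(c), the sum of the s (x) g(c): [lact x] is
    Delta followed by contraction with l, and the coordinates of l give back x. *)
Lemma lact_expand (q : 'I_n -> {additive S2 -> S}) :
  (forall i s t, q i (inl2 s * inr2 t) = phi (e' i s) * t) ->
  forall x, exists (l : lform C) (g : 'I_n -> lA),
    [/\ forall c, lact x c = lcontract l (comul c) :> C,
        x = \sum_i @apure R lA (calg phi) (g i) (e i)
      & forall i c, left_fun (g i) c = q i (l c)].
Proof.
move=> qP; elim/atens_ind => [g s|x y [l [g [lP gP glP]]] [m [h [mP hP hmP]]]].
  have lP : linear (fun c : restr inl2 C =>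
      inl2 s * inr2 (left_fun g c) : restr inr2 S2^o).
    move=> a c d; rewrite left_homD left_homZ rmorphD rmorphM mulrDr.
    by congr (_ + _); exact: mulrCA.
  exists (lin_of lP), (fun i => ralg_map lA (e' i s) * g); split.
  - move=> c; rewrite lactE /shift_right.
    elim/cotens_ind: (comul c) => [a b|z z' ez ez']; last first.
      by rewrite (raddfD (contract_right _)) (raddfD (lcontract _)) /= scalerDr ez ez'.
    by rewrite contract_rightE lcontractE /= scalerA.
  - rewrite [in LHS](eP s) [LHS](raddf_sum (add_of (@apureDr R lA (calg phi) g))).
    by apply: eq_bigr => i _; rewrite apureZ.
  - by move=> i c; rewrite lHom_map_mulE /= qP.
have lmP : linear (fun c : restr inl2 C => (l c + m c : restr inr2 S2^o)).
  by move=> a c d; rewrite !linearP scalerDr addrACA.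
exists (lin_of lmP), (fun i => g i + h i); split.
- move=> c; rewrite raddfD [LHS]lhomDE lP mP.
  elim/cotens_ind: (comul c) => [a b|z z' ez ez']; last first.
    by rewrite !raddfD /= -ez -ez' addrACA.
  by rewrite !lcontractE; exact/esym/(@scalerDl S2 C).
- by rewrite {1}gP {1}hP -big_split; apply: eq_bigr => i _; rewrite apureDl.
- by move=> i c; rewrite left_homDE glP hmP -raddfD.
Qed.

(** If the contraction with l vanishes on every Delta c, it vanishes everywhere, as the elements mid
    y (Delta c) generate. Hence l(d) c = 0 for all c and d, and l = 0 by faithfulness. *)
Lemma lact_inj x : lact x = 0 -> x = 0.
Proof.
have [q [q1 q2 q3]] := S2_coord eP e'D e'Z.
have [l [g [lP xP gP]]] := lact_expand q1 x => x0.
have l0 d : l d = 0 :> S2.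
  apply: faithC => c; rewrite scale0r -lcontractE.
  elim/(mid_comul_ind tdelta_bij): (copure c d) => [y a|z z' ez ez'].
    by rewrite lcontract_mid -lP x0 scaler0.
  by rewrite raddfD /= ez ez' addr0.
rewrite xP; apply: big1 => i _; have -> : g i = 0.
  by apply: left_homP => c; rewrite gP l0 raddf0.
exact: (balanced0l (@balanced_pure _ _ _)).
Qed.

(** F extends to [L] on C (x)_S C with L(mid y (Delta c)) = F(c) y. For fixed d, the map c |-> L(c
    (x) d) is linear over S (x) S, hence a scalar l(d) by [end_scalar]; so F(c) = l(c_(2)) c_(1),
    and the coordinates of l give the preimage. *)
Lemma lact_onto (F : End (restr inl2 C)) : exists x, lact x = F.
Proof.
have [q [q1 q2 q3]] := S2_coord eP e'D e'Z.
have FZ s c : F (inl2 s *: (c : C)) = inl2 s *: (F c : C) :> C.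
  exact: (linearZ_LR (F : endo _)).
have FD c d : F (c + d) = F c + F d by exact: raddfD.
have [L LP] : exists L : {additive CC -> C},
    forall y c, L (mid y (comul c)) = inr2 y *: (F c : C).
  apply: (mid_comul_lift tdelta_bij) => [c d y|c y y'|r c y].
  - by rewrite FD scalerDr.
  - by rewrite rmorphD scalerDl.
  - by rewrite FZ scalerA rmorphM phi2E mulrC.
have LZ s t z : L (mid t (inl2 s *: z)) = (inl2 s * inr2 t) *: L z.
  elim/(mid_comul_ind tdelta_bij): z => [y c|z z' ez ez']; last first.
    by rewrite scalerDr midD !(raddfD L) ez ez' scalerDr.
  rewrite -midZ midA -linearZ !LP FZ !scalerA rmorphM.
  by rewrite mulrC mulrA.
have Llin d : linear (fun c : C => L (copure c d)).
  move=> p a b; rewrite copureDl raddfD; congr (_ + _).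
  elim/S2_ind: p => [s t|p p' ep ep']; last first.
    by rewrite !scalerDl copureDl raddfD ep ep'.
  by rewrite -LZ scalel_copure mid_copure scalerA mulrC.
have /choice[l lP] : forall d, exists r : S2, forall c, L (copure c d) = r *: c.
  by move=> d; exact: (end_scalar tdelta_bij fpC (lin_of (Llin d))).
(* Faithfulness lets the identities for l be tested on an arbitrary c, where they become identities
   for [L]. *)
have llin : linear (l : restr inl2 C -> restr inr2 S2^o).
  move=> s a b; apply: faithC => c; rewrite -lP copureDr raddfD !lP scalerDl.
  congr (_ + _); rewrite -lP -copureZ lP scalerA mulrC.
  by [].
pose m : lform C := lin_of llin.
have Lm z : L z = lcontract m z.
  elim/cotens_ind: z => [c d|z z' ez ez']; last by rewrite !raddfD /= ez ez'.
  by rewrite lP lcontractE.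
have gD i c d : q i (l (c + d)) = q i (l c) + q i (l d).
  by rewrite -raddfD; congr (q i _); exact: (lformD m).
have gZ i s c : q i (l (inl2 s *: c)) = s * q i (l c).
  by rewrite -q2; congr (q i _); exact: (lformZ m).
pose g i : lA := mk_left (gD i) (gZ i).
exists (\sum_i @apure R lA (calg phi) (g i) (e i)); apply: lhomP => c.
have -> : F c = lcontract m (comul c).
  by rewrite -Lm -[comul c]mid1 LP rmorph1 scale1r.
rewrite raddf_sum.
rewrite lhom_sumE; under eq_bigr => i _ do rewrite lactE /shift_right.
elim/cotens_ind: (comul c) => [a b|z z' ez ez'].
  transitivity ((\sum_i inl2 (e i) * inr2 (q i (l b))) *: a); last first.
    by rewrite -q3 lcontractE.
  rewrite scaler_suml; apply: eq_bigr => i _.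
  by rewrite contract_rightE scalerA.
rewrite (raddfD (lcontract m)) /= -ez -ez' -big_split; apply: eq_bigr => i _.
by rewrite (raddfD (contract_right _)) scalerDr.
Qed.

End Bijectivity.
End DualActions.

(** * The action of right linear maps *)

Section RightDualAction.
Variables (R S : comPzRingType) (phi : {rmorphism R -> S}) (C : coring phi).
Local Notation inl2 := (inl2 phi).
Local Notation inr2 := (inr2 phi).
Local Notation mul2 := (mul2 phi).
Local Notation S2 := (S2 phi).
Local Notation CC := (cotens C C).
Local Notation comul := (comul C).
Local Notation rA := (rHom_alg C).


Lemma shift_left_linear (f : rA) :
  linear (shift_left (f : right_hom C) : restr inr2 C -> restr inr2 C).
Proof.
by move=> s c d; rewrite [LHS]shift_leftD; congr (_ + _); exact: shift_leftZ.
Qed.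
Definition shift_left_end (f : rA) : End (restr inr2 C) :=
  lin_of (@shift_left_linear f).

Definition ract_pure (f : rA) (s : calg phi) : End (restr inr2 C) :=
  ralg_map (End (restr inr2 C)) s * shift_left_end f.

Lemma ract_pureE f s c : ract_pure f s c = inr2 s *: shift_left (f : right_hom C) c.
Proof. by []. Qed.

Lemma rHom_mapE r c : right_fun (rHom_map C r) c = phi r * right_fun (rHom_one C) c.
Proof. by []. Qed.

Lemma rHom_mulE (f g : rA) c :
  right_fun (f * g) c = right_fun f (shift_left (g : right_hom C) c).
Proof. by []. Qed.

Lemma rHom_map_mulE r (g : rA) c :
  right_fun (ralg_map rA r * g) c = phi r * right_fun g c.
Proof.
rewrite rHom_mulE rHom_mapE.
by rewrite -[right_fun _ (shift_left _ _)]/(right_fun (1 * g) c) mul1r.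
Qed.

Lemma shift_left1 c : shift_left (rHom_one C) c = c.
Proof. exact: counitl. Qed.

Let ract_pureDl f f' s : ract_pure (f + f') s = ract_pure f s + ract_pure f' s.
Proof.
apply: lhomP => c; rewrite lhomDE !ract_pureE -scalerDr.
by congr (_ *: _); exact: shift_left_add.
Qed.
Let ract_pureDr f s s' : ract_pure f (s + s') = ract_pure f s + ract_pure f s'.
Proof. by rewrite /ract_pure rmorphD mulrDl. Qed.
Let ract_pureZ r f s :
  ract_pure (ralg_map rA r * f) s = ract_pure f (ralg_map (calg phi) r * s).
Proof.
apply: lhomP => c; rewrite !ract_pureE rmorphM mulrC -scalerA; congr (_ *: _).
rewrite /shift_left -contract_leftZ.
elim/cotens_ind: (comul c) => [a b|x y ex ey]; last first.
  by rewrite scalerDr !(raddfD (contract_left _)) /= ex ey.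
rewrite scaler_copure !contract_leftE rHom_map_mulE.
by rewrite -phi2E scalerA rmorphM mulrC.
Qed.

Definition ract : atens rA (calg phi) -> End (restr inr2 C) :=
  atens_lift ract_pureDl ract_pureDr ract_pureZ.
HB.instance Definition _ := GRing.Additive.on ract.

Lemma ractE f s c : ract (apure f s) c = inr2 s *: shift_left (f : right_hom C) c.
Proof. by rewrite /ract atens_liftE. Qed.

(** Here [shift_left] of f # g is [shift_left f] after [shift_left g], so the order of the factors
    is kept. *)
Lemma ractM x y : ract (x * y) = ract x * ract y.
Proof.
elim/atens_ind: x => [g s|x x' e e']; last by rewrite mulrDl !(raddfD ract) /= mulrDl e e'.
elim/atens_ind: y => [f t|y y' e e']; last by rewrite mulrDr !(raddfD ract) /= mulrDr e e'.
rewrite apureM; apply: lhomP => c.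
rewrite -[RHS]/(ract _ (ract _ c)) !ractE shift_leftZ scalerA.
rewrite -rmorphM; congr (_ *: _).
exact/esym/(@shift_left_mul _ _ _ C g f c).
Qed.

Lemma ract_ainr s : ract (apure 1 s) = ralg_map (End (restr inr2 C)) s.
Proof. by apply: lhomP => c; rewrite ractE shift_left1. Qed.


Section Bijectivity.
Variables (n : nat) (e : 'I_n -> S) (e' : 'I_n -> S -> R).
Hypothesis eP : forall s, s = \sum_i phi (e' i s) * e i.
Hypothesis e'D : forall i s t, e' i (s + t) = e' i s + e' i t.
Hypothesis e'Z : forall i r s, e' i (phi r * s) = r * e' i s.
Hypothesis tdelta_bij : bijective (tdelta (C := C)).
Hypothesis fpC : faithfully_projective (coring_mod C).

Let faithC (r r' : S2) : (forall c : C, r *: c = r' *: c) -> r = r'.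
Proof. by case: fpC => _ _; exact: faithful_inj. Qed.

(** Mirror of [lact_expand]: the first factor is contracted, so l takes the values g(c) (x) s, and
    coordinates are taken over the left slot. *)
Lemma ract_expand (q : 'I_n -> {additive S2 -> S}) :
  (forall i s t, q i (inr2 s * inl2 t) = phi (e' i s) * t) ->
  forall x, exists (l : rform C) (g : 'I_n -> rA),
    [/\ forall c, ract x c = rcontract l (comul c) :> C,
        x = \sum_i @apure R rA (calg phi) (g i) (e i)
      & forall i c, right_fun (g i) c = q i (l c)].
Proof.
move=> qP; elim/atens_ind => [g s|x y [l [g [lP gP glP]]] [m [h [mP hP hmP]]]].
  have lP : linear (fun c : restr inr2 C =>
      inr2 s * inl2 (right_fun g c) : restr inl2 S2^o).
    move=> a c d; rewrite right_homD right_homZ rmorphD rmorphM mulrDr.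
    by congr (_ + _); exact: mulrCA.
  exists (lin_of lP), (fun i => ralg_map rA (e' i s) * g); split.
  - move=> c; rewrite ractE /shift_left.
    elim/cotens_ind: (comul c) => [a b|z z' ez ez']; last first.
      by rewrite (raddfD (contract_left _)) (raddfD (rcontract _)) /= scalerDr ez ez'.
    by rewrite contract_leftE rcontractE /= scalerA.
  - rewrite [in LHS](eP s) [LHS](raddf_sum (add_of (@apureDr R rA (calg phi) g))).
    by apply: eq_bigr => i _; rewrite apureZ.
  - by move=> i c; rewrite rHom_map_mulE /= qP.
have lmP : linear (fun c : restr inr2 C => (l c + m c : restr inl2 S2^o)).
  by move=> a c d; rewrite !linearP scalerDr addrACA.
exists (lin_of lmP), (fun i => g i + h i); split.
- move=> c; rewrite raddfD [LHS]lhomDE lP mP.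
  elim/cotens_ind: (comul c) => [a b|z z' ez ez']; last first.
    by rewrite !raddfD /= -ez -ez' addrACA.
  by rewrite !rcontractE; exact/esym/(@scalerDl S2 C).
- by rewrite {1}gP {1}hP -big_split; apply: eq_bigr => i _; rewrite apureDl.
- by move=> i c; rewrite right_homDE glP hmP -raddfD.
Qed.

Lemma ract_inj x : ract x = 0 -> x = 0.
Proof.
have [q [q1 q2 q3]] := S2_coord_twist eP e'D e'Z.
have [l [g [lP xP gP]]] := ract_expand q1 x => x0.
have l0 d : l d = 0 :> S2.
  apply: faithC => c; rewrite scale0r -rcontractE.
  elim/(mid_comul_ind tdelta_bij): (copure d c) => [y a|z z' ez ez'].
    by rewrite rcontract_mid -lP x0 scaler0.
  by rewrite raddfD /= ez ez' addr0.
rewrite xP; apply: big1 => i _; have -> : g i = 0.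
  by apply: right_homP => c; rewrite gP l0 raddf0.
exact: (balanced0l (@balanced_pure _ _ _)).
Qed.

(** Now L(mid y (Delta c)) = y F(c), and the first argument is fixed: d |-> L(c (x) d) is a scalar
    l(c), whence F(c) = l(c_(1)) c_(2). *)
Lemma ract_onto (F : End (restr inr2 C)) : exists x, ract x = F.
Proof.
have [q [q1 q2 q3]] := S2_coord_twist eP e'D e'Z.
have FZ s c : F (inr2 s *: (c : C)) = inr2 s *: (F c : C) :> C.
  exact: (linearZ_LR (F : endo _)).
have FD c d : F (c + d) = F c + F d by exact: raddfD.
have [L LP] : exists L : {additive CC -> C},
    forall y c, L (mid y (comul c)) = inl2 y *: (F c : C).
  apply: (mid_comul_lift tdelta_bij) => [c d y|c y y'|r c y].
  - by rewrite FD scalerDr.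
  - by rewrite rmorphD scalerDl.
  - by rewrite phi2E FZ -phi2E scalerA rmorphM mulrC.
have LZ s t z : L (mid s (inr2 t *: z)) = (inl2 s * inr2 t) *: L z.
  elim/(mid_comul_ind tdelta_bij): z => [y c|z z' ez ez']; last first.
    by rewrite scalerDr midD !(raddfD L) ez ez' scalerDr.
  rewrite -midZ midA -linearZ !LP FZ !scalerA rmorphM.
  by rewrite mulrAC.
have Llin c : linear (fun d : C => L (copure c d)).
  move=> p a b; rewrite copureDr raddfD; congr (_ + _).
  elim/S2_ind: p => [s t|p p' ep ep']; last first.
    by rewrite !scalerDl copureDr raddfD ep ep'.
  by rewrite -LZ scaler_copure mid_copure copureZ scalerA.
have /choice[l lP] : forall c, exists r : S2, forall d, L (copure c d) = r *: d.
  by move=> c; exact: (end_scalar tdelta_bij fpC (lin_of (Llin c))).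
have llin : linear (l : restr inr2 C -> restr inl2 S2^o).
  move=> s a b; apply: faithC => c; rewrite -lP copureDl raddfD !lP scalerDl.
  by congr (_ + _); rewrite -lP copureZ lP scalerA mulrC.
pose m : rform C := lin_of llin.
have Lm z : L z = rcontract m z.
  elim/cotens_ind: z => [c d|z z' ez ez']; last by rewrite !raddfD /= ez ez'.
  by rewrite lP rcontractE.
have gD i c d : q i (l (c + d)) = q i (l c) + q i (l d).
  by rewrite -raddfD; congr (q i _); exact: (rformD m).
have gZ i s c : q i (l (inr2 s *: c)) = s * q i (l c).
  by rewrite -q2; congr (q i _); exact: (rformZ m).
pose g i : rA := mk_right (gD i) (gZ i).
exists (\sum_i @apure R rA (calg phi) (g i) (e i)); apply: lhomP => c.
have -> : F c = rcontract m (comul c).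
  by rewrite -Lm -[comul c]mid1 LP rmorph1 scale1r.
rewrite raddf_sum.
rewrite lhom_sumE; under eq_bigr => i _ do rewrite ractE /shift_left.
elim/cotens_ind: (comul c) => [a b|z z' ez ez'].
  transitivity ((\sum_i inr2 (e i) * inl2 (q i (l a))) *: b); last first.
    by rewrite -q3 rcontractE.
  rewrite scaler_suml; apply: eq_bigr => i _.
  by rewrite contract_leftE scalerA.
rewrite (raddfD (rcontract m)) /= -ez -ez' -big_split; apply: eq_bigr => i _.
by rewrite (raddfD (contract_left _)) scalerDr.
Qed.

End Bijectivity.
End RightDualAction.

(** * Duals and splitting *)

Lemma raddf_bij (U V : zmodType) (f : {additive U -> V}) :
  (forall x, f x = 0 -> x = 0) -> (forall y, exists x, f x = y) -> bijective f.
Proof.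
move=> f_inj /choice[g gK]; exists g => // x.
by apply/subr0_eq/f_inj; rewrite raddfB /= gK subrr.
Qed.

Section Dual.
Variables (R : comPzRingType) (M : lmodType R).

Definition dual : Type := lhom M R^o.
HB.instance Definition _ := GRing.Zmodule.copy dual (lhom M R^o).

Lemma dual_scale_subproof (a : R) (f : dual) :
  linear (fun m => a * (f : lhom M R^o) m : R^o).
Proof. by move=> b m m'; rewrite linearP mulrDr; congr (_ + _); exact: mulrCA. Qed.
Definition dual_scale (a : R) (f : dual) : dual :=
  lin_of (dual_scale_subproof a f).

Let dual_scaleA a b f : dual_scale a (dual_scale b f) = dual_scale (a * b) f.
Proof. by apply: lhomP => m; exact: mulrA. Qed.
Let dual_scale1 : left_id 1 dual_scale.
Proof. by move=> f; apply: lhomP => m; exact: mul1r. Qed.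
Let dual_scaleDr : right_distributive dual_scale +%R.
Proof. by move=> a f g; apply: lhomP => m; exact: mulrDr. Qed.
Let dual_scaleDl f : {morph dual_scale^~ f : a b / a + b}.
Proof. by move=> a b; apply: lhomP => m; exact: mulrDl. Qed.

HB.instance Definition _ := GRing.Zmodule_isLmodule.Build R dual
  dual_scaleA dual_scale1 dual_scaleDr dual_scaleDl.

Lemma dual_scaleE a (f : dual) m :
  (a *: f : lhom M R^o) m = a * ((f : lhom M R^o) m : R) :> R.
Proof. by []. Qed.

Lemma dual_sumE (I : Type) (r : seq I) (f : I -> dual) m :
  ((\sum_(i <- r) f i : dual) : lhom M R^o) m = \sum_(i <- r) (f i : lhom M R^o) m.
Proof. exact: (@lhom_sumE R M R^o). Qed.

Lemma dual_expand n (e : 'I_n -> M) (e' : 'I_n -> {linear M -> R^o}) (f : dual) :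
  dual_basis e e' -> f = \sum_i ((f : lhom M R^o) (e i) : R) *: (e' i : dual).
Proof.
move=> eP; apply: lhomP => m; rewrite dual_sumE {1}(eP m) linear_sum.
by apply: eq_bigr => i _; rewrite linearZ dual_scaleE; exact: mulrC.
Qed.

(** The forms e'_i have the evaluations at the e_i as dual forms. A scalar that kills every e'_i
    kills every m, by expansion of m. *)
Lemma faithfully_projective_dual :
  faithfully_projective M -> faithfully_projective dual.
Proof.
move=> [fgM prM faM]; have [n [e [e' eP]]] := dual_basis_exists fgM prM.
have evP i : linear (fun f : dual => (f : lhom M R^o) (e i) : R^o) by [].
have dP : dual_basis (fun i => e' i : dual) (fun i => lin_of (evP i)).
  by move=> f; exact: dual_expand.
split; [exact: fg_dual_basis dP | exact: projective_dual_basis dP |].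
move=> r r0; apply: faM => m; rewrite (eP m) scaler_sumr big1 // => i _.
rewrite scalerA -[r * _]/(((r *: (e' i : dual) : dual) : lhom M R^o) m : R) r0.
exact: scale0r.
Qed.

Section Transpose.
Variable F : endo M.
Lemma transpose_subproof :
  linear (fun f : dual => ((f : {linear M -> R^o}) \o F : {linear M -> R^o}) : dual).
Proof. by move=> a f g; apply: lhomP. Qed.
Definition transpose : endo dual := lin_of transpose_subproof.
End Transpose.

Lemma transposeE F (f : dual) m :
  (transpose F f : lhom M R^o) m = (f : lhom M R^o) (F m).
Proof. by []. Qed.

Lemma transposeD F G : transpose (F + G) = transpose F + transpose G.
Proof. by apply: lhomP => f; apply: lhomP => m; exact: (raddfD (f : lhom M R^o)). Qed.

Lemma transposeM F G : transpose (F * G) = transpose G * transpose F.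
Proof. by apply: lhomP => f; apply: lhomP. Qed.

Lemma transpose_homothety a :
  transpose (homothety M a) = homothety (dual : lmodType R) a.
Proof.
by apply: lhomP => f; apply: lhomP => m; exact: (linearZ_LR (f : lhom M R^o)).
Qed.

Lemma transpose_inj n (e : 'I_n -> M) e' F :
  dual_basis e e' -> transpose F = 0 -> F = 0.
Proof.
move=> eP F0; apply: lhomP => m; rewrite (eP (F m)) big1 // => i _.
rewrite -[e' i (F m)]/((transpose F (e' i : dual) : lhom M R^o) m) F0.
exact: scale0r.
Qed.

Lemma transpose_onto n (e : 'I_n -> M) e' (T : endo (dual : lmodType R)) :
  dual_basis e e' -> exists F, transpose F = T.
Proof.
(* The equation e'_i(F(m)) = T(e'_i)(m) forces F(m) to be the sum of the T(e'_i)(m) e_i. *)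
move=> eP; pose c i m : R := (T (e' i : dual) : lhom M R^o) m.
have Flin : linear (fun m => \sum_i c i m *: e i).
  move=> a m m'; rewrite scaler_sumr -big_split; apply: eq_bigr => i _.
  by rewrite /c linearP scalerDl scalerA.
exists (lin_of Flin); apply: lhomP => f; apply: lhomP => m.
rewrite transposeE linear_sum [in RHS](dual_expand f eP) linear_sum.
rewrite dual_sumE; apply: eq_bigr => i _.
by rewrite linearZ [T _]linearZ dual_scaleE; exact: mulrC.
Qed.

End Dual.

Lemma alg_iso_of (R : comPzRingType) (B B' : ralg R) (F : {additive B -> B'}) :
  bijective F -> (forall x y, F (x * y) = F x * F y) ->
  (forall r, F (ralg_map B r) = ralg_map B' r) -> alg_iso B B'.
Proof.
move=> F_bij FM FR.
(* The unit is the image of 1 in R, so compatibility with the structure maps preserves it. *)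
have Fm : monoid_morphism F by split=> //; rewrite -(rmorph1 (ralg_map B)) FR rmorph1.
pose mF := GRing.isMonoidMorphism.Build B B' F Fm.
pose rF : {rmorphism B -> B'} := HB.pack (GRing.Additive.sort F) mF.
by exists rF.
Qed.

Section Neutral.
Variables (S : comPzRingType) (B : ralg S) (P : lmodType S).
Local Notation E1 := (End (S^o : lmodType S)).
Local Notation S1 := (calg (idfun : {rmorphism S -> S})).
Local Notation EP := (End P).

Let ev1 (f : E1) : S := (f : endo (S^o : lmodType S)) 1.
Let ev1E (f : E1) : f = ralg_map E1 (ev1 f).
Proof.
apply: lhomP => s; rewrite -{1}[s]mulr1.
by rewrite [LHS](linearZ_LR (f : endo _)) [RHS]mulrC.
Qed.

(** Because End_S(S) = S by evaluation at 1, an isomorphism F from B to End(P) gives one from B (x)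
    End(S) to S (x) End(P), sending b (x) f to f(1) (x) F(b). *)
Lemma brauer_equiv_neutral :
  faithfully_projective P -> alg_iso B EP -> brauer_equiv B S1.
Proof.
move=> fpP [F [[G FK GK] FS]]; exists (S^o : lmodType S), P.
split=> //; first exact: faithfully_projective_regular.
have GD : {morph G : x y / x + y}.
  by move=> x y; apply: (can_inj FK); rewrite raddfD /= !GK.
have GM : {morph G : x y / x * y}.
  by move=> x y; apply: (can_inj FK); rewrite rmorphM /= !GK.
have GS s : G (ralg_map EP s) = ralg_map B s by rewrite -FS FK.
pose h (b : B) (f : E1) : atensor S1 EP := @apure S S1 EP (ev1 f) (F b).
have h1 b b' f : h (b + b') f = h b f + h b' f by rewrite /h raddfD apureDr.
have h2 b f f' : h b (f + f') = h b f + h b f'.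
  exact: (@apureDl S S1 EP (ev1 f) (ev1 f')).
have h3 s b f : h (ralg_map B s * b) f = h b (ralg_map E1 s * f).
  by rewrite /h rmorphM /= FS -apureZ.
pose k (s : S1) (f : EP) : atensor B E1 := @apure S B E1 (G f) (ralg_map E1 s).
have k1 s s' f : k (s + s') f = k s f + k s' f by rewrite /k rmorphD apureDr.
have k2 s f f' : k s (f + f') = k s f + k s f' by rewrite /k GD apureDl.
have k3 r s f : k (ralg_map S1 r * s) f = k s (ralg_map EP r * f).
  by rewrite /k GM GS apureZ rmorphM.
pose H : {additive atensor B E1 -> atensor S1 EP} := atens_lift h1 h2 h3.
pose K : {additive atensor S1 EP -> atensor B E1} := atens_lift k1 k2 k3.
have HE b f : H (@apure S B E1 b f) = @apure S S1 EP (ev1 f) (F b).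
  exact: atens_liftE.
have KE s f : K (@apure S S1 EP s f) = @apure S B E1 (G f) (ralg_map E1 s).
  exact: atens_liftE.
apply: (@alg_iso_of _ _ _ H).
- exists K => [|x].
    elim/atens_ind => [b f|x y ex ey]; last by rewrite !raddfD /= ex ey.
    by rewrite HE KE FK -ev1E.
  elim/atens_ind: x => [s f|x y ex ey]; last by rewrite !raddfD /= ex ey.
  by rewrite KE HE GK; congr apure; exact: mulr1.
- move=> x y; elim/atens_ind: x => [b f|x x' e e']; last first.
    by rewrite mulrDl !(raddfD H) /= mulrDl e e'.
  elim/atens_ind: y => [b' f'|y y' e e']; last first.
    by rewrite mulrDr !(raddfD H) /= mulrDr e e'.
  rewrite apureM !HE apureM rmorphM; congr apure.
  rewrite {1}(ev1E f) {1}(ev1E f').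
  by rewrite -rmorphM; exact: mulr1.
move=> s; rewrite -[ralg_map _ s]/(@apure S B E1 (ralg_map B s) 1) HE FS.
by rewrite -[ralg_map EP s]mulr1 -apureZ; congr apure; exact: mulr1.
Qed.

End Neutral.

(** The products b_j e_i have the composites of b'_j after e'_i as dual forms over A; the pairs (i,
    j) are renumbered by an ordinal. *)
Lemma restr_dual_basis (A B : comPzRingType) (f : {rmorphism A -> B})
    (M : lmodType B) n (e : 'I_n -> M) e' k (b : 'I_k -> restr f B^o) b' :
  dual_basis e e' -> dual_basis b b' ->
  exists l (x : 'I_l -> restr f M) x', dual_basis x x'.
Proof.
move=> eP bP; pose I : finType := ('I_n * 'I_k)%type.
pose c (p : I) (m : restr f M) : A := b' p.2 (e' p.1 m : restr f B^o).
have cP (p : I) : linear (c p : restr f M -> A^o).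
  by move=> a u v; rewrite /c [a *: u]restrE linearP; exact: (linearP (b' p.2)).
pose x (p : I) : restr f M := (b p.2 : B) *: (e p.1 : M).
exists #|I|, (fun i => x (enum_val i)), (fun i => lin_of (cP (enum_val i))) => m.
transitivity (\sum_(p : I) c p m *: x p); last first.
  rewrite (reindex (@enum_val I predT)) //=.
  by apply: onW_bij; exact: enum_val_bij.
rewrite -(pair_bigA _ (fun i j => c (i, j) m *: x (i, j))) /= {1}[m]eP.
apply: eq_bigr => i _; rewrite [X in X *: _](bP (e' i m)) scaler_suml.
by apply: eq_bigr => j _; rewrite [in RHS]restrE scalerA.
Qed.

(** Faithfulness survives because the retraction [g] makes [f] injective; for either inclusion of S
    into S (x) S the retraction is [mul2]. *)
Lemma restr_faithfully_projective (A B : comPzRingType) (f : {rmorphism A -> B})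
    (g : {rmorphism B -> A}) (M : lmodType B) k (b : 'I_k -> restr f B^o) b' :
  cancel f g -> dual_basis b b' ->
  faithfully_projective M -> faithfully_projective (restr f M).
Proof.
move=> fK bP [fgM prM faM].
have [n [e [e' eP]]] := dual_basis_exists fgM prM.
have [l [x [x' xP]]] := restr_dual_basis eP bP.
split; [exact: fg_dual_basis xP | exact: projective_dual_basis xP |].
move=> r r0; rewrite -[r]fK -[RHS](rmorph0 g); congr (g _).
exact: faM.
Qed.

(** S serves both as the faithfully flat extension and as the splitting ring, so one isomorphism
    proves both claims. *)
Lemma split_azumaya (R S : comPzRingType) (phi : {rmorphism R -> S})
    (A : ralg R) (P : lmodType S) :
  faithfully_projective (restr phi S^o) -> faithfully_projective P ->
  alg_iso (alg_base_change A phi) (End P) -> azumaya A /\ split_by phi A.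
Proof.
move=> fpS fpP isoA; split; last exact: brauer_equiv_neutral isoA.
by exists S, phi, P; split=> //; exact: faithfully_projective_flat.
Qed.

Theorem proposition4p4 (R S : comPzRingType) (phi : {rmorphism R -> S})
    (hS : faithfully_projective (restr phi S^o))
    (C : coring phi) (hC : azumaya_coring C) :
  (azumaya (lHom_alg C) /\ split_by phi (lHom_alg C)) /\
  (azumaya (rHom_alg C) /\ split_by phi (rHom_alg C)).
Proof.
have [fpC tdelta_bij] := hC; have [fgS prS _] := hS.
have [n [e [e' eP]]] := dual_basis_exists fgS prS.
(* The coordinates are restated with S as a plain ring, on which R acts through a visible [phi]. *)
pose c i (s : S) : R := e' i s.
have cP (s : S) : s = \sum_i phi (c i s) * e i := eP s.
have cD i s t : c i (s + t) = c i s + c i t by exact: (raddfD (e' i)).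
have cZ i r s : c i (phi r * s) = r * c i s := linearZ_LR (e' i) r s.
split.
  have [b' bP] := dual_basis_inl2 cP cD cZ.
  have fpM := restr_faithfully_projective (@mul2l _ _ phi) bP fpC.
  apply: split_azumaya hS (faithfully_projective_dual fpM) _.
  have [fgM prM _] := fpM; have [k [x [x' xP]]] := dual_basis_exists fgM prM.
  (* Both [lact] and transposition reverse products, so their composite preserves them; its target
     is the endomorphism ring of the S-dual of C. *)
  have FD : {morph (fun z => transpose (@lact R S phi C z)) : z z' / z + z'}.
    by move=> z z'; rewrite (raddfD (@lact _ _ phi C)); exact: transposeD.
  pose T : {additive alg_base_change (lHom_alg C) phi ->
    End (dual (restr (inl2 phi) C) : lmodType S)} := add_of FD.
  apply: (@alg_iso_of _ _ _ T).
  - apply: raddf_bij => [z /(transpose_inj xP)|F].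
      exact: (lact_inj cP cD cZ tdelta_bij fpC).
    have [G <-] := transpose_onto F xP.
    by have [z <-] := lact_onto cP cD cZ tdelta_bij fpC G; exists z.
  - by move=> z z'; rewrite [LHS]/(transpose (@lact R S phi C (z * z'))) lactM; exact: transposeM.
  move=> s; apply: etrans (transpose_homothety _ s).
  exact: (congr1 (@transpose _ _) (lact_ainr C s)).
(* [ract] already preserves products, so C itself, as a right S-module, is the splitting module. *)
have [b' bP] := dual_basis_inr2 cP cD cZ.
have fpM := restr_faithfully_projective (@mul2r _ _ phi) bP fpC.
apply: split_azumaya hS fpM _.
pose T : {additive alg_base_change (rHom_alg C) phi ->
  End (restr (inr2 phi) C : lmodType S)} := @ract R S phi C.
apply: (@alg_iso_of _ _ _ T).
- apply: raddf_bij => [z|F].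
    exact: (ract_inj cP cD cZ tdelta_bij fpC).
  exact: (ract_onto cP cD cZ tdelta_bij fpC).
- exact: ractM.
exact: ract_ainr.
Qed.
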